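(* Let $G$ be a finite simple decomposable subcubic graph. Then $\chi_{\mathrm{irr}}'(G) \le 4$.
   Context: All graphs are finite and simple. A graph is subcubic if its maximum degree is at most $3$. A graph is locally irregular if for every vertex $v$ all neighbors of $v$ have degrees distinct from the degree of $v$ (equivalently, any two adjacent vertices have distinct degrees). A locally irregular edge-coloring of a graph $G$ is a (not necessarily proper) edge-coloring of $G$ such that, for every color, the subgraph formed by the edges of that color is locally irregular. A graph is decomposable if it admits a locally irregular edge-coloring. For a decomposable graph $G$, the locally irregular chromatic index $\chi_{\mathrm{irr}}'(G)$ is the smallest number of colors in a locally irregular edge-coloring of $G$. *)

(* Defs.v *)
From mathcomp Require Import all_boot.

Set Implicit Arguments.
Unset Strict Implicit.
Unset Printing Implicit Defensive.

Record sgraph := SGraph {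
  vertex :> finType;
  adjacent : rel vertex;
  adjacent_sym : symmetric adjacent;
  adjacent_irr : irreflexive adjacent
}.

Section Graph.
Variable G : sgraph.

Definition degree (v : G) : nat := #|[set u | adjacent v u]|.

Definition max_degree : nat := \max_(v : G) degree v.

Definition subcubic : Prop := max_degree <= 3.

Definition locally_irregular : bool :=
  [forall u : G, forall v : G, adjacent u v ==> (degree u != degree v)].

Definition edges : {set {set G}} :=
  [set [set p.1; p.2] | p : G * G & adjacent p.1 p.2].

Definition edge : finType := {e : {set G} | e \in edges}.

End Graph.

Section EdgeColoring.
Variables (G : sgraph) (k : nat) (c : {ffun edge G -> 'I_k}) (i : 'I_k).

Definition color_adjacent : rel G :=
  fun u v => [exists e : edge G, (val e == [set u; v]) && (c e == i)].

Lemma color_adjacent_sym : symmetric color_adjacent.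
Proof.
by move=> u v; apply: eq_existsb => e; rewrite [[set u; v]]setUC.
Qed.

Lemma color_adjacent_irr : irreflexive color_adjacent.
Proof.
move=> u; apply/negbTE/negP => /existsP[[e he] /= /andP[/eqP ee _]].
case/imsetP: he => -[x y]; rewrite inE /= ee => xy /esym /setP exy.
have /eqP xu : x == u by have := exy x; rewrite !inE eqxx orbb.
have /eqP yu : y == u by have := exy y; rewrite !inE eqxx orbb orbT.
by move: xy; rewrite xu yu adjacent_irr.
Qed.

(* Spanning subgraph: the vertices missed by color i are kept as isolated
   vertices, which does not affect local irregularity. *)
Definition color_subgraph : sgraph :=
  SGraph color_adjacent_sym color_adjacent_irr.

End EdgeColoring.

Definition locally_irregular_coloring (G : sgraph) (k : nat)
    (c : {ffun edge G -> 'I_k}) : bool :=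
  [forall i : 'I_k, locally_irregular (color_subgraph c i)].

(* Not every color has to be used. For k = 0 this says that G is edgeless. *)
Definition locally_irregular_colorable (G : sgraph) (k : nat) : bool :=
  [exists c : {ffun edge G -> 'I_k}, locally_irregular_coloring c].

Definition decomposable (G : sgraph) : Prop :=
  exists k : nat, locally_irregular_colorable G k.

Definition chi_irr (G : sgraph) (dec : decomposable G) : nat := ex_minn dec.

(* Main.v *)
Require Import Defs.
From mathcomp Require Import all_boot.

Set Implicit Arguments.
Unset Strict Implicit.
Unset Printing Implicit Defensive.

(** Orient every edge away from a chosen end, its center. If all out-degrees are
    0 or 2, then the edges are partitioned into paths of length 2 given by their
    middle vertices, and we color the edges by coloring these vertices. Such a
    coloring is locally irregular if (i) at every sink the colors of the
    in-neighbours are pairwise distinct, or there are three of them with the same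
    color, and (ii) there is no monochromatic path w -> x -> y whose end y is a
    center or a sink with three in-neighbours of that color. In the conflict
    graph of the centers (two centers conflict if they have a common sink) a
    component either is cubic-like and can be colored with a single color, or it
    has a vertex with slack and can be colored greedily. The monochromatic paths
    through centers are then removed by recoloring their middle vertices.

    A locally irregular coloring yields an orientation in which every vertex of
    odd out-degree is the center of a claw, or has out-degree 1 and belongs to a
    tree with legs of lengths 1, 2, 2. Reversing walks between such vertices leaves
    at most one of them in each component, and the claw or tree around it gets a
    single color as well. *)

(** Conditions (i) and (ii) work because of the degrees in a single color: a center of out-degree 2
    has 2, or 3 if its only in-neighbour shares its color, and a sink has 1 or 3. The number four
    comes from the conflicts: each of the two out-neighbours of a center costs at most two colors,
    so four colors miss a greedy choice by one, as in Brooks' theorem, and one vertex with slack per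
    component makes up for it. The main obstacle is the tree around a vertex of out-degree 1. It is
    precolored, and one further vertex has to avoid its color. If that vertex lies in a cubic-like
    component that also meets the tree at a sink, a constant color on this component fails; a
    minimal set of its vertices is then colored greedily. For a claw the color can be chosen late
    instead. Decomposability enters only through the initial orientation: there an odd vertex has
    degree 3 and a single color around it, which rules out the one triangle that would prevent the
    tree. Reversing an edge changes the parity of the out-degree at its two ends only, so odd
    vertices can be moved along walks. *)

Lemma list_coloring (T C : finType) (c0 : C) (L : rel T) (X : T -> {set C})
    (A : {set T}) :
  symmetric L ->
  (forall B : {set T}, B \subset A -> B != set0 ->
     exists2 x, x \in B & #|X x| + #|[set y in B | L x y]| < #|C|) ->
  exists c : T -> C,
    (forall x, x \in A -> c x \notin X x) /\
    (forall x y, x \in A -> y \in A -> x != y -> L x y -> c x != c y).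
Proof.
move=> symL; have [n] := ubnP #|A|; elim: n A => // n IHn A ltA degA.
have [->|A0] := eqVneq A set0.
  by exists (fun=> c0); split=> [x|x y]; rewrite inE.
have [x xA xdeg] := degA A (subxx _) A0.
have [||c [cX cL]] := IHn (A :\ x).
- by move: ltA; rewrite (cardsD1 x) xA.
- by move=> B sBA; apply: degA; apply: subset_trans sBA (subD1set _ _).
pose F := X x :|: [set c y | y in [set y in A | L x y]].
have [k kF] : exists k, k \notin F.
  have ltF : #|F| < #|C|.
    apply: leq_ltn_trans xdeg; apply: leq_trans (leq_card_setU _ _) _.
    by rewrite leq_add2l leq_imset_card.
  apply/existsP; apply: contraTT ltF; rewrite negb_exists -leqNgt => /forallP h.
  by rewrite -cardsT subset_leq_card //; apply/subsetP=> k _; have := h k; rewrite negbK.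
have kL y : y \in A -> L x y -> k != c y.
  move=> yA xy; apply: contraNneq kF => ->; rewrite inE; apply/orP; right.
  by apply: imset_f; rewrite inE yA.
exists (fun y => if y == x then k else c y); split=> [y yA|y z yA zA yz Lyz].
  case: eqVneq => [->|yx]; first by apply: contra kF => kX; rewrite inE kX.
  by apply: cX; rewrite !inE yx.
case: (eqVneq y x) Lyz yz => [-> Lxz xz|yx Lyz yz].
  by rewrite [z == x]eq_sym (negbTE xz) kL.
case: (eqVneq z x) Lyz => [-> Lyx|zx Lyz]; first by rewrite eq_sym kL // symL.
by apply: cL; rewrite ?inE ?yx ?zx.
Qed.

(** * Coloring orientations with even out-degrees *)

Section Digraph.
Variables (V : finType) (D : rel V).

Definition outs x := [set y | D x y].
Definition ins y := [set x | D x y].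
Definition sink x := outs x == set0.
Definition conflict x y :=
  (x != y) && [exists s, [&& sink s, D x s & D y s]].

Lemma conflict_sym : symmetric conflict.
Proof.
move=> x y; rewrite /conflict eq_sym; congr andb.
by apply: eq_existsb => s; rewrite [D x s && _]andbC.
Qed.

Lemma conflictP x y :
  reflect (x != y /\ exists s, [/\ sink s, D x s & D y s]) (conflict x y).
Proof.
apply: (iffP andP) => -[xy].
  by case/existsP=> s /and3P[]; split=> //; exists s.
by case=> s [sS xs ys]; split=> //; apply/existsP; exists s; apply/and3P.
Qed.

Lemma arc_nsink x y : D x y -> ~~ sink x.
Proof. by move=> xy; apply/set0Pn; exists y; rewrite inE. Qed.

Section Coloring.
Variable c : V -> 'I_4.

Definition rainbow s := [forall x in ins s, forall y in ins s, (c x == c y) ==> (x == y)].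
Definition monochrome s :=
  (#|ins s| == 3) && [forall x in ins s, forall y in ins s, c x == c y].
(** A same-colored arc into a vertex above a monochrome sink would raise its color degree to 3, the
    degree of that sink. Vertices of [Z] are pinned because their color degrees are prescribed. *)
Definition pinned (Z : {set V}) a :=
  (a \in Z) || [exists s, [&& D a s, sink s & monochrome s]].

Lemma rainbowP s : reflect {in ins s &, injective c} (rainbow s).
Proof.
apply: (iffP forall_inP) => [h x y xs ys cxy|h x xs].
  by have /forall_inP/(_ y ys)/implyP := h x xs; rewrite cxy eqxx => /(_ isT)/eqP.
by apply/forall_inP=> y ys; apply/implyP=> /eqP cxy; apply/eqP/h.
Qed.

Lemma monochromeP s :
  reflect (#|ins s| = 3 /\ {in ins s &, forall x y, c x = c y}) (monochrome s).
Proof.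
apply: (iffP andP) => [[/eqP s3 h]|[/eqP s3 h]]; split=> //.
  by move=> x y xs ys; have /forall_inP/(_ x xs)/forall_inP/(_ y ys)/eqP := h.
by apply/forall_inP=> x xs; apply/forall_inP=> y ys; apply/eqP/h.
Qed.

Lemma rainbow_not_monochrome s : rainbow s -> ~~ monochrome s.
Proof.
move/rainbowP=> inj; apply/monochromeP=> -[s3 eqc].
have: 1 < #|ins s| by rewrite s3.
by case/card_gt1P=> x [y [xs ys]]; rewrite (inj x y xs ys (eqc x y xs ys)) eqxx.
Qed.

End Coloring.

(* [good c] collects the local conditions under which coloring each arc by its
   tail is almost irregular: only monochromatic directed paths remain to be
   avoided. *)
Definition good (Z : {set V}) (k : 'I_4) (c : V -> 'I_4) :=
  [/\ forall z, z \in Z -> c z = k,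
      forall s, sink s -> rainbow c s || monochrome c s &
      forall x a, D x a -> pinned c Z a -> ~~ ((x \in Z) && (a \in Z)) ->
        c x != c a].

(** In the tree case [Z] is the odd vertex with its two in-neighbours, precolored 0, and [U] holds
    at most one further vertex, which must avoid 0; otherwise both are empty. By [Z_outs], a pinned
    vertex outside [Z] that is entered from [Z] belongs to [U]. *)
Variables (Z U : {set V}).
Hypothesis degD : forall x, #|outs x| + #|ins x| <= 3.
Hypothesis outsD : forall x, x \notin Z -> ~~ sink x -> #|outs x| = 2.
Hypothesis nsinkZ : forall z, z \in Z -> ~~ sink z.
Hypothesis insZ : forall s, sink s -> #|ins s :&: Z| <= 1.
Hypothesis U_inj : forall x y, x \in U -> y \in U -> x = y.
Hypothesis U_out : forall x, x \in U -> x \notin Z /\ ~~ sink x.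
Hypothesis Z_outs : forall z a, z \in Z -> D z a -> a \notin Z -> sink a || (a \in U).

(** * Greedy extension of a partial coloring *)

Section Core.
Variables (T : {set V}) (cp : V -> 'I_4).
Hypothesis T_nsink : forall x, x \in T -> x \notin Z /\ ~~ sink x.

(* [T] is the set of vertices still to be colored and [cp] the coloring of the
   others. A colored in-neighbour of a sink always has color 0, so the remaining
   in-neighbours must avoid 0; a colored nonsink forbids its own color. *)
Definition excl s : {set 'I_4} :=
  if sink s then (if ins s \subset T then set0 else [set ord0])
  else if s \in T then set0 else [set cp s].
Definition nbrs x s : {set V} :=
  if sink s then [set y in ins s | (y != x) && (y \in T)] else set0.
Definition wt x s := #|excl s| + #|nbrs x s|.
Definition exclT x := (if x \in U then [set ord0] else set0) :|: \bigcup_(s in outs x) excl s.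
Definition conflictT x := [set y in T | conflict x y].
Definition tot x := #|exclT x| + #|conflictT x|.

(** The in-neighbours outside [T] together forbid only the color 0, so they never cost more than
    their number, and [x] itself costs nothing. *)
Lemma wt_sink x s : x \in T -> D x s -> sink s -> wt x s < #|ins s|.
Proof.
move=> xT xs sS; rewrite /wt /excl /nbrs sS.
have xi : x \in ins s by rewrite inE.
case: ifPn => [sT|/subsetPn[z zs zT]].
  rewrite cards0 add0n [ltnRHS](cardsD1 x) xi ltnS subset_leq_card //.
  by apply/subsetP=> y; rewrite !inE => /and3P[-> -> _].
have zx : z != x by apply: contraNneq zT => ->.
rewrite cards1 [ltnRHS](cardsD1 x) xi (cardsD1 z (ins s :\ x)) !inE zx /= -[D z s]/(D z s).
move: zs; rewrite inE => ->; rewrite !add1n !ltnS subset_leq_card //.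
apply/subsetP=> y; rewrite !inE => /and3P[-> -> yT]; rewrite !andbT /=.
by apply: contraTneq yT => ->.
Qed.

Lemma wt_nsink x s : ~~ sink s -> wt x s <= 1.
Proof.
move=> /negbTE sS; rewrite /wt /excl /nbrs sS cards0 addn0.
by case: ifP; rewrite ?cards0 ?cards1.
Qed.

Lemma insD_le3 s : #|ins s| <= 3.
Proof. by apply: leq_trans (degD s); rewrite leq_addl. Qed.

Lemma wt_le2 x s : x \in T -> D x s -> wt x s <= 2.
Proof.
move=> xT xs; have [sS|sS] := boolP (sink s).
  by rewrite -ltnS; apply: leq_trans (wt_sink xT xs sS) (insD_le3 s).
by apply: leq_trans (wt_nsink x sS) _.
Qed.

Lemma outsT x : x \in T -> exists a b, [/\ a != b, outs x = [set a; b], D x a & D x b].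
Proof.
move=> xT; have [xZ xS] := T_nsink xT.
have /eqP/cards2P[a [b [ab E]]] := outsD xZ xS; exists a, b; split=> //.
  by have: a \in outs x by [rewrite E !inE eqxx]; rewrite inE.
by have: b \in outs x by [rewrite E !inE eqxx orbT]; rewrite inE.
Qed.

Lemma conflictT_sub x a b : outs x = [set a; b] ->
  conflictT x \subset nbrs x a :|: nbrs x b.
Proof.
move=> E; apply/subsetP=> y; rewrite !inE => /andP[yT /conflictP[xy [s [sS xs ys]]]].
have: s \in outs x by rewrite inE.
rewrite E !inE => /orP[] /eqP e; move: sS ys; rewrite e => sS ys; rewrite /nbrs sS.
  by rewrite !inE ys yT eq_sym xy.
by apply/orP; right; rewrite !inE ys yT eq_sym xy.
Qed.

Lemma exclT_def x a b : outs x = [set a; b] -> a != b ->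
  exclT x = (if x \in U then [set ord0] else set0) :|: (excl a :|: excl b).
Proof. by move=> E ab; rewrite /exclT E bigcup_setU !big_set1. Qed.

Lemma tot_le x a b : outs x = [set a; b] -> a != b ->
  tot x <= (x \in U) + (wt x a + wt x b).
Proof.
move=> E ab; rewrite /tot (exclT_def E ab) /wt.
have := leq_trans (subset_leq_card (conflictT_sub E)) (leq_card_setU _ _).
have := leq_card_setU (if x \in U then [set ord0] else set0) (excl a :|: excl b).
have := leq_card_setU (excl a) (excl b).
have -> : #|if x \in U then [set (@ord0 3)] else set0| = (x \in U).
  by case: ifP; rewrite ?cards1 ?cards0.
move=> h1 h2 h3; apply: leq_trans (leq_add h2 h3) _.
rewrite -addnA leq_add2l addnACA leq_add2r; exact: h1.
Qed.

(* If [x] must avoid color 0 anyway, an out-neighbour forbidding 0 costs nothing. *)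
Lemma tot_le_U x a b : outs x = [set a; b] -> a != b -> x \in U ->
  excl a \subset [set ord0] -> tot x <= 1 + (#|nbrs x a| + wt x b).
Proof.
move=> E ab xU ea; rewrite /tot (exclT_def E ab) xU /wt.
have -> : [set ord0] :|: (excl a :|: excl b) = [set ord0] :|: excl b.
  by rewrite setUA (setUidPl ea).
have := leq_trans (subset_leq_card (conflictT_sub E)) (leq_card_setU _ _).
have := leq_card_setU [set (@ord0 3)] (excl b); rewrite cards1.
move=> h2 h3; apply: leq_trans (leq_add h2 h3) _.
by rewrite -addnA leq_add2l addnCA.
Qed.

Lemma tot_le4 x : x \in T -> x \notin U -> tot x <= 4.
Proof.
move=> xT /negbTE xU; have [a [b [ab E xa xb]]] := outsT xT.
apply: leq_trans (tot_le E ab) _; rewrite xU add0n.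
exact: leq_add (wt_le2 xT xa) (wt_le2 xT xb).
Qed.

Lemma card_nbrs2 x s y : y \in nbrs x s -> #|nbrs x s| = 2 ->
  exists2 y', y' \in nbrs x s & y' != y.
Proof.
move=> ys s2; have : 0 < #|nbrs x s :\ y| by move: s2; rewrite (cardsD1 y) ys add1n => -[->].
by case/card_gt0P=> y'; rewrite !inE => /andP[? ?]; exists y'.
Qed.

(** The vertex of [U] must also avoid 0, so its total can reach 5. Exceeding 4 forces every
    out-neighbour that carries a conflict to carry exactly two; these share a sink and so conflict
    with each other. *)
Lemma tot_U x : x \in T -> x \in U ->
  tot x <= 4 \/ (tot x <= 5 /\ forall y, y \in conflictT x ->
    exists y', [/\ y' \in conflictT x, y' != y & conflict y y']).
Proof.
move=> xT xU; have [a [b [ab E xa xb]]] := outsT xT.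
have [wa wb] := (wt_le2 xT xa, wt_le2 xT xb).
have [|t4] := leqP (tot x) 4; [by left | right].
split; first by apply: leq_trans (tot_le E ab) _; rewrite xU -[5]/(1 + (2 + 2)) leq_add2l leq_add.
have key s s' : outs x = [set s; s'] -> s != s' -> D x s -> D x s' ->
    forall y, y \in nbrs x s ->
    exists y', [/\ y' \in conflictT x, y' != y & conflict y y'].
  move=> {}E ss' xs xs' y ys; have w's' := wt_le2 xT xs'.
  have sS : sink s by move: ys; rewrite /nbrs; case: ifP; rewrite ?inE.
  have [sT|sT] := boolP (ins s \subset T); last first.
    have ws := wt_le2 xT xs.
    have e0 : excl s = [set ord0] by rewrite /excl sS (negbTE sT).
    have := tot_le_U E ss' xU; rewrite e0 subxx => /(_ isT) h.
    move: ws; rewrite /wt e0 cards1 ltnS => ws.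
    by move: t4; rewrite ltnNge (leq_trans h) // -[4]/(1 + (1 + 2)) leq_add2l leq_add.
  have s2 : #|nbrs x s| = 2.
    have ws := wt_le2 xT xs; have e0 : excl s = set0 by rewrite /excl sS sT.
    have := tot_le E ss'; rewrite xU => h; have := leq_trans t4 h.
    move: ws; rewrite {1 2}/wt e0 cards0 !add0n => ws h2.
    apply/eqP; rewrite eqn_leq ws /=.
    have := leq_trans h2 (leq_add (leqnn 1) (leq_add (leqnn _) w's')).
    by rewrite -[5]/(1 + (2 + 2)) leq_add2l leq_add2r.
  have [y' y's yy'] := card_nbrs2 ys s2; exists y'; move: ys y's; rewrite /nbrs sS !inE.
  case/and3P=> ys yx yT /and3P[y's y'x y'T]; split=> //.
    rewrite y'T; apply/conflictP; split; first by rewrite eq_sym.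
    by exists s.
  by apply/conflictP; split; [rewrite eq_sym | exists s].
move=> y yC; have := subsetP (conflictT_sub E) y yC; rewrite inE => /orP[].
  exact: (key a b).
by apply: (key b a); rewrite // 1?setUC // eq_sym.
Qed.

Hypothesis T_root : forall B : {set V}, B \subset T -> B != set0 ->
  (forall x y, x \in B -> y \in T -> conflict x y -> y \in B) ->
  exists2 r, r \in B & tot r < 4.

(** [T_root] serves the sets closed under conflict. In any other [B], a vertex with a conflict
    outside [B] gains the missing unit. For a vertex of [U] one unit may not suffice; then the
    companion [y'] from [tot_U] is outside [B] too, or is itself a boundary vertex outside [U]. *)
Lemma core_coloring : exists c : V -> 'I_4,
  (forall x, x \in T -> c x \notin exclT x) /\
  (forall x y, x \in T -> y \in T -> conflict x y -> c x != c y).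
Proof.
have [] := @list_coloring V 'I_4 ord0 conflict exclT T conflict_sym; last first.
  by move=> c [cX cL]; exists c; split=> // x y xT yT xy; apply: cL => //; case/andP: xy.
move=> B sBT B0; rewrite card_ord.
have [cl|ncl] := boolP [forall x in B, forall y in T, conflict x y ==> (y \in B)].
  have [|r rB rt] := T_root sBT B0.
    by move=> x y xB yT; have /forall_inP/(_ x xB)/forall_inP/(_ y yT)/implyP := cl.
  exists r => //; apply: leq_ltn_trans rt; rewrite leq_add2l subset_leq_card //.
  by apply/subsetP=> y; rewrite !inE => /andP[/(subsetP sBT)-> ->].
have boundary x y : x \in B -> x \notin U -> y \in T -> y \notin B -> conflict x y ->
    exists2 x, x \in B & #|exclT x| + #|[set y in B | conflict x y]| < 4.
  move=> xB xU yT yB xy; exists x => //; have xT := subsetP sBT x xB.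
  apply: leq_trans (tot_le4 xT xU); rewrite ltn_add2l (cardsD1 y (conflictT x)).
  rewrite !inE yT xy add1n ltnS subset_leq_card //.
  apply/subsetP=> w; rewrite !inE => /andP[wB ->]; rewrite (subsetP sBT) //= andbT.
  by apply: contraNneq yB => <-.
move: ncl; rewrite negb_forall => /existsP[x]; rewrite negb_imply => /andP[xB].
rewrite negb_forall => /existsP[y]; rewrite negb_imply => /andP[yT].
rewrite negb_imply => /andP[xy yB].
have [xU|] := boolP (x \in U); last by move=> xU; apply: (boundary x y).
have xT := subsetP sBT x xB; have yC : y \in conflictT x by rewrite inE yT.
have sC : [set y in B | conflict x y] \subset conflictT x :\ y.
  apply/subsetP=> w; rewrite !inE => /andP[wB ->]; rewrite (subsetP sBT) //= andbT.
  by apply: contraNneq yB => <-.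
have [t4|[t5 mate]] := tot_U xT xU.
  exists x => //; apply: leq_trans t4; rewrite ltn_add2l (cardsD1 y (conflictT x)) yC.
  by rewrite ltnS subset_leq_card.
have [y' [y'C y'y yy']] := mate y yC; move: (y'C); rewrite inE => /andP[y'T xy'].
have [y'B|y'B] := boolP (y' \in B).
  apply: (boundary y' y); rewrite // 1?conflict_sym //.
  apply: contraTN xy' => /(U_inj xU) <-; by rewrite /conflict eqxx.
exists x => //; rewrite -ltnS; apply: leq_trans t5; rewrite -!addnS leq_add2l.
rewrite (cardsD1 y (conflictT x)) yC add1n ltnS (cardsD1 y' (_ :\ _)) !inE y'y y'T xy' /=.
rewrite add1n ltnS subset_leq_card //; apply/subsetP=> w; rewrite !inE => /andP[wB cw].
rewrite (subsetP sBT) // cw !andbT; apply/andP; split.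
  by apply: contraNneq y'B => <-.
by apply: contraNneq yB => <-.
Qed.

Hypothesis rest_full : forall x s, x \notin T -> x \notin Z -> D x s ->
  sink s /\ #|ins s| = 3.
Hypothesis rest_le1 : forall x s, sink s -> x \in T -> D x s ->
  #|ins s :\: T| <= 1 /\ forall y, y \in ins s -> y \notin T -> cp y = ord0.
Hypothesis rest_mono : forall s, sink s -> [disjoint ins s & T] ->
  #|ins s| <= 1 \/ #|ins s| = 3 /\ {in ins s &, forall x y, cp x = cp y}.
Hypothesis cpZ : forall z, z \in Z -> cp z = ord0.
Hypothesis cpU : forall x, x \in U -> x \notin T -> cp x != ord0.

(** Sinks entered from [T] become rainbow, so a pinned vertex outside [Z] was colored by [cp]. Being
    no sink, it is entered only from [T], where [excl] forbids its color, or from [Z], where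
    [Z_outs] puts it into [U]. *)
Lemma core_good : exists c : V -> 'I_4,
  good Z ord0 c /\ forall x, x \in U -> c x != ord0.
Proof.
have [c [cX cL]] := core_coloring.
pose c' x := if x \in T then c x else cp x.
have ZT z : z \in Z -> z \notin T by apply: contraL => /T_nsink[].
have cexcl x s : x \in T -> D x s -> c x \notin excl s.
  move=> xT xs; apply: contra (cX x xT); rewrite inE => xe; apply/orP; right.
  by apply/bigcupP; exists s; rewrite ?inE.
have c'U x : x \in U -> c' x != ord0.
  move=> xU; rewrite /c'; case: ifPn => [xT|/(cpU xU)//].
  by apply: contraNneq (cX x xT) => ->; rewrite /exclT xU !inE.
have touched x s : x \in T -> sink s -> D x s -> rainbow c' s.
  move=> xT sS xs; apply/rainbowP => y y' ys y's; rewrite /c'.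
  have [le1 cp0] := rest_le1 sS xT xs.
  have out_in w w' : w \in ins s -> w' \in ins s -> w \in T -> w' \notin T ->
      c w != cp w'.
    move=> ws w's wT w'T; rewrite cp0 //; have := cexcl w s wT; rewrite /excl sS.
    case: ifPn => [/subsetP/(_ _ w's)|_]; first by rewrite (negbTE w'T).
    by rewrite inE => -> //; rewrite inE in ws.
  case: ifPn => yT; case: ifPn => y'T e.
  - apply: contra_eq e => yy'; apply: cL => //; apply/conflictP; split=> //.
    by exists s; rewrite !inE in ys y's.
  - by have := out_in y y' ys y's yT y'T; rewrite e eqxx.
  - by have := out_in y' y y's ys y'T yT; rewrite e eqxx.
  - by apply: (card_le1_eqP le1); rewrite inE ?yT ?y'T.
exists c'; split=> //; split.
- by move=> z zZ; rewrite /c' (negbTE (ZT z zZ)) cpZ.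
- move=> s sS; have [dis|] := boolP [disjoint ins s & T]; last first.
    rewrite -setI_eq0 => /set0Pn[x]; rewrite !inE => /andP[xs xT].
    by rewrite (touched x).
  case: (rest_mono sS dis) => [le1|[s3 eqc]].
    by apply/orP; left; apply/rainbowP=> x y xs ys _; apply: (card_le1_eqP le1).
  apply/orP; right; apply/monochromeP; split=> // x y xs ys; rewrite /c'.
  by rewrite (disjointFr dis xs) (disjointFr dis ys); apply: eqc.
move=> x a xa; rewrite /pinned; case: (boolP (a \in Z)) => [aZ _|aZ].
  rewrite andbT => xZ; have aT := ZT a aZ; have aS := nsinkZ aZ.
  have [xT|xT] := boolP (x \in T); last first.
    by have [] := rest_full xT xZ xa; rewrite (negbTE aS).
  rewrite /c' xT (negbTE aT); have := cexcl x a xT xa.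
  by rewrite /excl (negbTE aS) (negbTE aT) inE.
case/existsP=> s /and3P[as_ sS mono] _.
have aT : a \notin T.
  by apply: contraL mono => aT; apply: rainbow_not_monochrome (touched a s aT sS as_).
have aS := arc_nsink as_.
have [xT|xT] := boolP (x \in T).
  have := cexcl x a xT xa; rewrite /excl (negbTE aS) (negbTE aT) inE.
  by rewrite /c' xT (negbTE aT).
have [xZ|xZ] := boolP (x \in Z); last first.
  by have [] := rest_full xT xZ xa; rewrite (negbTE aS).
have := Z_outs xZ xa aZ; rewrite (negbTE aS) /= => aU.
by rewrite {1}/c' (negbTE xT) cpZ // eq_sym c'U.
Qed.

Lemma tot_lt4 x s : x \in T -> x \notin U -> D x s -> wt x s <= 1 -> tot x < 4.
Proof.
move=> xT /negbTE xU xs w1; have [a [b [ab E xa xb]]] := outsT xT.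
apply: leq_ltn_trans (tot_le E ab) _; rewrite xU add0n.
have: s \in outs x by rewrite inE.
rewrite E !inE => /orP[] /eqP e; subst s.
  by apply: leq_ltn_trans (leq_add w1 (wt_le2 xT xb)) _.
by apply: leq_ltn_trans (leq_add (wt_le2 xT xa) w1) _.
Qed.

Lemma outsT_with x s : x \in T -> D x s -> exists t, [/\ s != t, outs x = [set s; t] & D x t].
Proof.
move=> xT xs; have [a [b [ab E xa xb]]] := outsT xT.
have: s \in outs x by rewrite inE.
rewrite E !inE => /orP[] /eqP e; subst s; first by exists b.
by exists a; rewrite eq_sym setUC.
Qed.

(** A center, or a sink with at most two in-neighbours, costs one color instead of two, which is the
    slack. If [y] is in [U], the ban on 0 uses it up; then either [s] forbids at most 0 again, at no
    cost, or another in-neighbour of [s] is a root. *)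
Lemma root_easy (B : {set V}) y s :
  B \subset T ->
  (forall x y, x \in B -> y \in T -> conflict x y -> y \in B) ->
  (forall x y, x \in U -> x \in T -> y \notin T -> cp y = ord0) ->
  y \in B -> D y s -> ~~ sink s || (#|ins s| <= 2) ->
  exists2 r, r \in B & tot r < 4.
Proof.
move=> sBT Bcl cp0 yB ys bad; have yT := subsetP sBT y yB.
have w1 x : x \in T -> D x s -> wt x s <= 1.
  move=> xT xs; have [sS|/wt_nsink//] := boolP (sink s).
  move: bad; rewrite sS /= => le2.
  by rewrite -ltnS (leq_trans (wt_sink xT xs sS) le2).
have [yU|yU] := boolP (y \in U); last by exists y => //; apply: tot_lt4 yT yU ys (w1 y yT ys).
have [t [st E yt]] := outsT_with yT ys.
have e0 : excl s \subset [set ord0].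
  rewrite /excl; case: ifP => _; case: ifPn => sT; rewrite ?sub0set ?subxx //.
  by rewrite (cp0 y s).
have [n0|/set0Pn[x]] := eqVneq (nbrs y s) set0.
  exists y => //; apply: leq_ltn_trans (tot_le_U E st yU e0) _.
  by rewrite n0 cards0 !ltnS (wt_le2 yT yt).
rewrite /nbrs; case: ifPn => sS; last by rewrite inE.
rewrite !inE => /and3P[xs xy xT].
exists x; first by apply: (Bcl y) => //; apply/conflictP; split; [rewrite eq_sym | exists s].
apply: (tot_lt4 xT _ xs (w1 x xT xs)).
by apply: contra xy => xU; rewrite (U_inj xU yU).
Qed.

End Core.

(** * Components of the conflict graph without slack *)

Definition free x := (x \notin Z) && ~~ sink x.
Definition link x y := [&& free x, free y & conflict x y].

Lemma link_sym : symmetric link.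
Proof. by move=> x y; rewrite /link conflict_sym andbCA. Qed.

Lemma connect_link_sym : connect_sym link.
Proof. by apply: sym_connect_sym; apply: link_sym. Qed.

(* [full x]: the component of [x] in the conflict graph is cubic, in the sense
   that all out-neighbours of its vertices are sinks with three in-neighbours. *)
Definition full x := free x &&
  [forall y, connect link x y ==> [forall s, D y s ==> (sink s && (#|ins s| == 3))]].

Lemma fullP x s : full x -> D x s -> sink s /\ #|ins s| = 3.
Proof.
case/andP=> _ /forallP/(_ x)/implyP/(_ (connect0 _ _))/forallP/(_ s)/implyP h xs.
by have /andP[? /eqP] := h xs.
Qed.

Lemma full_connect x y : connect link x y -> full x -> full y.
Proof.
move=> xy /andP[fx /forallP h]; apply/andP; split; last first.
  by apply/forallP=> z; apply/implyP=> yz; apply: (implyP (h z)); apply: connect_trans yz.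
case/connectP: xy => p; elim: p x fx {h} => [|w p IHp] x fx /=; first by move=> _ ->.
by case/andP=> /and3P[_ fw _] pp e; apply: (IHp w).
Qed.

Lemma full_conflict x y : full x -> free y -> conflict x y -> full y.
Proof.
move=> fx fy xy; apply: (full_connect _ fx); apply: connect1; apply/and3P; split=> //.
by case/andP: fx.
Qed.

Lemma not_full x : free x -> ~~ full x ->
  exists y s, [/\ connect link x y, D y s & ~~ sink s || (#|ins s| <= 2)].
Proof.
move=> fx; rewrite /full fx /= negb_forall => /existsP[y]; rewrite negb_imply => /andP[xy].
rewrite negb_forall => /existsP[s]; rewrite negb_imply => /andP[ys].
rewrite negb_and => bad; exists y, s; split=> //.
case/orP: bad => [->//|s3]; rewrite -ltnS ltn_neqAle s3 orbC.
by rewrite (leq_trans _ (degD s)) ?leq_addl.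
Qed.

Lemma free_not_sink x s : D x s -> x \notin Z -> free x.
Proof. by move=> /arc_nsink xS xZ; rewrite /free xZ. Qed.

Lemma conflict_at x y s : sink s -> D x s -> D y s -> x != y -> conflict x y.
Proof. by move=> sS xs ys xy; apply/conflictP; split=> //; exists s. Qed.

(** Free in-neighbours of a common sink lie in the same component, so only members of [Z] can fail
    to be full. *)
Lemma full_ins x s : full x -> D x s -> ins s :\: [set y | full y] = ins s :&: Z.
Proof.
move=> fx xs; have [sS _] := fullP fx xs; apply/setP=> y; rewrite !inE andbC.
have [ys|//] := boolP (D y s); rewrite /=; have [yZ|yZ] := boolP (y \in Z).
  by apply/negP=> /andP[]; rewrite /free yZ.
apply/negbF; have [<-//|xy] := eqVneq x y.
by apply: full_conflict fx _ (conflict_at sS xs ys xy); apply: free_not_sink ys yZ.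
Qed.

Definition full_set := [set x | full x].

(* The components that are not cubic are colored by the list coloring lemma. *)
Lemma tot_root (T : {set V}) (cp : V -> 'I_4) (B : {set V}) x :
  (forall x, x \in T -> free x) ->
  (forall x, free x -> x \notin T -> full x) ->
  (forall x y, x \in U -> x \in T -> y \notin T -> cp y = ord0) ->
  B \subset T ->
  (forall x y, x \in B -> y \in T -> conflict x y -> y \in B) ->
  x \in B -> ~~ full x -> exists2 r, r \in B & tot T cp r < 4.
Proof.
move=> Tf Tfull cp0 sBT Bcl xB nfx.
have [y [s [xy ys bad]]] := not_full (Tf x (subsetP sBT x xB)) nfx.
have Tns z : z \in T -> z \notin Z /\ ~~ sink z by move=> /Tf/andP.
apply: (root_easy Tns sBT Bcl cp0 _ ys bad).
have nfull u v : connect link u v -> ~~ full u -> ~~ full v.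
  by move=> uv; apply: contra; apply: full_connect; rewrite connect_link_sym.
case/connectP: xy => p; elim: p x xB nfx => [|w p IHp] x xB nfx /=; first by move=> _ ->.
case/andP=> xw pp e; apply: (IHp w) => //; last by apply: nfull nfx; apply: connect1.
case/and3P: (xw) => fx fw cxw; apply: (Bcl x) => //.
apply: contraR (nfull x w (connect1 xw) nfx); exact: Tfull.
Qed.

(** No sink below the component of [P] is entered from [Z], so this component can take one color
    other than 0, here [ord_max], while the other full components take 0. *)
Lemma good_closed P : P \in U -> full P ->
  (forall y s, connect link P y -> D y s -> [disjoint ins s & Z]) ->
  exists c : V -> 'I_4, good Z ord0 c /\ forall x, x \in U -> c x != ord0.
Proof.
move=> PU fP disj; pose T := [set x | free x && ~~ full x].
pose cp x : 'I_4 := if connect link P x then ord_max else ord0.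
have Tns z : z \in T -> z \notin Z /\ ~~ sink z by rewrite inE => /andP[/andP].
have notT x : x \notin T -> x \notin Z -> ~~ sink x -> full x.
  by rewrite inE negb_and negbK => /orP[/negbTE fx xZ xS|//]; rewrite /free xZ xS in fx.
have Z0 z : z \in Z -> cp z = ord0.
  move=> zZ; rewrite /cp; case: ifP => // /full_connect/(_ fP)/andP[/andP[]].
  by rewrite zZ.
apply: (@core_good T cp) => //.
- move=> B sBT /set0Pn[x xB] Bcl; have := subsetP sBT x xB; rewrite inE => /andP[_ nfx].
  apply: (tot_root _ _ _ sBT Bcl xB nfx) => y.
  + by rewrite inE => /andP[].
  + by rewrite inE => -> /=; rewrite negbK.
  + by move=> z yU; rewrite (U_inj yU PU) inE fP andbF.
- by move=> x s xT xZ xs; apply: (fullP _ xs); apply: notT (arc_nsink xs).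
- move=> x s sS; rewrite inE => /andP[fx nfx] xs.
  have sub y : y \in ins s -> y \notin T -> y \in Z.
    rewrite inE => ys yT; apply: contraR nfx => yZ.
    have [<-|yx] := eqVneq y x; first exact: notT yT yZ (arc_nsink ys).
    exact: full_conflict (notT y yT yZ (arc_nsink ys)) fx (conflict_at sS ys xs yx).
  split; last by move=> y ys yT; apply: Z0; apply: sub.
  apply: leq_trans (insZ sS); apply: subset_leq_card; apply/subsetP=> y.
  by rewrite in_setD in_setI => /andP[yT ys]; rewrite ys sub.
- move=> s sS dis.
  have [sZ|/subsetPn[x xs xZ]] := boolP (ins s \subset Z).
    by left; rewrite -(setIidPl sZ) insZ.
  have xs' : D x s by rewrite inE in xs.
  have fx := notT x (negbT (disjointFr dis xs)) xZ (arc_nsink xs').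
  right; have [_ s3] := fullP fx xs'; split=> //.
  have same y : y \in ins s -> cp y = cp x.
    move=> ys; have ys' : D y s by rewrite inE in ys.
    have [->//|yx] := eqVneq y x.
    have [yZ|yZ] := boolP (y \in Z).
      rewrite Z0 // /cp; case: ifP => // /disj/(_ xs')/disjointFr/(_ ys).
      by rewrite yZ.
    have xy : link x y.
      apply/and3P; split; first by case/andP: fx.
        by rewrite /free yZ (arc_nsink ys').
      by apply: conflict_at ys' _; rewrite // eq_sym.
    by rewrite /cp (same_connect_r connect_link_sym (connect1 xy)).
  by move=> y z ys zs; rewrite !same.
- by move=> x xU _; rewrite (U_inj xU PU) /cp connect0.
Qed.

Lemma cards3P (S : {set V}) x : x \in S -> #|S| = 3 ->
  exists y z, [/\ y != z, y != x, z != x & S = [set x; y; z]].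
Proof.
move=> xS; rewrite (cardsD1 x) xS add1n => -[/eqP/cards2P[y [z [yz E]]]].
have: y \in S :\ x by rewrite E !inE eqxx.
have: z \in S :\ x by rewrite E !inE eqxx orbT.
rewrite !inE => /andP[zx _] /andP[yx _]; exists y, z; split=> //.
by rewrite -(setD1K xS) E setUA.
Qed.

(** * Minimal sets of full vertices to be colored greedily *)

Section Minimal.
Variable X : {set V}.
(* If all of [full_set :\: Y] gets color 0, then a sink has no, one or three
   in-neighbours colored 0 in advance, so it can still be made rainbow or
   monochrome. *)
Definition thin (Y : {set V}) :=
  [&& Y \subset full_set, U :&: full_set \subset Y &
    [forall s, (sink s && (ins s :&: full_set != set0)) ==>
      (#|ins s :\: Y| \in [:: 0; 1; 3])]].
Hypothesis minX : minset thin X.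
Hypothesis U_open : forall P, P \in U -> full P ->
  exists y s, [/\ connect link P y, D y s & ~~ [disjoint ins s & Z]].

Let T := [set x | free x && ~~ full x] :|: X.
Let cp (x : V) : 'I_4 := ord0.

Lemma thinX : thin X.
Proof. by case/minsetP: minX. Qed.

Lemma X_full x : x \in X -> full x.
Proof. by case/and3P: thinX => /subsetP h _ _ /h; rewrite inE. Qed.

Lemma X_ins x s : x \in X -> D x s -> #|ins s :\: X| <= 1.
Proof.
move=> xX xs; have [sS s3] := fullP (X_full xX) xs.
case/and3P: thinX => _ _ /forallP/(_ s)/implyP.
have -> : sink s && (ins s :&: full_set != set0).
  by rewrite sS; apply/set0Pn; exists x; rewrite !inE xs (X_full xX).
move=> /(_ isT); have : #|ins s :\: X| < 3.
  by rewrite -s3 -(cardsID X (ins s)) -{1}[#|_ :\: _|]add0n ltn_add2r card_gt0;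
    apply/set0Pn; exists x; rewrite !inE xs.
by case: #|_| => [|[|[|n]]].
Qed.

(** This is how minimality is exploited. Sinks not entered from [Q] keep their count, and at the
    others the count cannot be 0, so only the value 2 has to be avoided. *)
Lemma X_remove (Q : {set V}) : Q \subset X -> Q != set0 -> [disjoint Q & U] ->
  (forall x s, x \in Q -> D x s -> #|ins s :\: (X :\: Q)| \in [:: 1; 3]) -> False.
Proof.
move=> sQX Q0 disQ h; suff : thin (X :\: Q).
  case/minsetP: minX => _ min /min /(_ (subsetDl _ _)) E.
  case/set0Pn: Q0 => x xQ; have := subsetP sQX x xQ.
  by rewrite -E inE xQ.
case/and3P: thinX => XF UX /forallP h0; apply/and3P; split.
- exact: subset_trans (subsetDl _ _) XF.
- by rewrite subsetD UX /= disjoint_sym; apply: disjointWr disQ; apply: subsetIl.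
apply/forallP=> s; apply/implyP=> sS; have := implyP (h0 s) sS.
have [dis|] := boolP [disjoint ins s & Q].
  suff -> : ins s :\: (X :\: Q) = ins s :\: X by [].
  apply/setP=> x; rewrite !in_setD; case xs : (x \in ins s); rewrite ?andbF ?andbT //.
  by rewrite (disjointFr dis xs).
rewrite -setI_eq0 => /set0Pn[x]; rewrite !inE => /andP[xs xQ] _.
by have := h x s xQ xs; rewrite !inE => ->; rewrite orbT.
Qed.

(* A component of [X] without slack contains vertices that can be removed from
   [X], against minimality. *)
Lemma min_root (B : {set V}) : B \subset X -> B != set0 ->
  (forall x y, x \in B -> y \in T -> conflict x y -> y \in B) ->
  exists2 r, r \in B & tot T cp r < 4.
Proof.
move=> sBX B0 Bcl; apply/exists_inP; apply: contraT => /exists_inPn noroot.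
have Tns z : z \in T -> z \notin Z /\ ~~ sink z.
  rewrite !inE => /orP[/andP[/andP[]]//|/X_full/andP[/andP[]//]].
have XT : X \subset T by apply: subsetUr.
have BT : B \subset T by apply: subset_trans sBX XT.
have exclT1 x : #|exclT T cp x| <= 1.
  suff /subset_leq_card : exclT T cp x \subset [set ord0] by rewrite cards1.
  rewrite subUset; apply/andP; split.
    by case: ifP; rewrite ?sub0set.
  apply/bigcupsP=> s _; rewrite /excl; case: ifP => _; case: ifP => _;
    by rewrite ?sub0set ?subxx.
(* All vertices outside [T] have color 0, so at most one color is excluded; without a root, every
   vertex of [B] therefore has at least three conflicts in [T]. *)
have big x (S : {set V}) : x \in B -> conflictT T x \subset S -> #|S| <= 2 -> False.
  move=> xB sS S2; have := noroot x xB; rewrite -leqNgt => h.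
  have := leq_trans h (leq_add (exclT1 x) (subset_leq_card sS)).
  by rewrite -[4]/(1 + 3) leq_add2l ltnNge S2.
have Bins x y s : x \in B -> D x s -> y \in T -> D y s -> y \in B.
  move=> xB xs yT ys; have [<-//|xy] := eqVneq x y; apply: (Bcl x) => //.
  by apply: (conflict_at _ xs ys xy); case: (fullP (X_full (subsetP sBX x xB)) xs).
have confsub x s t : x \in B -> outs x = [set s; t] ->
    conflictT T x \subset ((ins s :|: ins t) :&: T) :\ x.
  move=> xB E; apply/subsetP=> y; rewrite !inE => /andP[yT /conflictP[xy [w [wS xw yw]]]].
  rewrite yT andbT eq_sym xy /=; have: w \in outs x by rewrite inE.
  by rewrite E !inE => /orP[] /eqP <-; rewrite yw ?orbT.
have outsB x s : x \in B -> D x s -> exists t, [/\ s != t, outs x = [set s; t] & D x t].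
  by move=> xB xs; have [] := outsT_with Tns (subsetP BT x xB) xs; move=> t; exists t.
(* Otherwise all of [B] could leave [X]: since [B] is closed, each sink below it would then have all
   three in-neighbours outside. *)
have [P PB PU] : exists2 P, P \in B & P \in U.
  apply/exists_inP; apply: contraT => /exists_inPn noU; case: (X_remove sBX B0).
    rewrite -setI_eq0; apply/set0Pn=> -[x]; rewrite !inE => /andP[xB].
    by apply/negP/noU.
  move=> x s xB xs; have [_ s3] := fullP (X_full (subsetP sBX x xB)) xs.
  rewrite (_ : ins s :\: _ = ins s) ?s3 //; apply/setP=> y; rewrite !inE.
  case: (boolP (D y s)) => ys; rewrite ?andbF ?andbT //.
  case: (boolP (y \in X)) => yX; rewrite ?andbF // andbT negbK.
  exact: Bins xB xs (subsetP XT y yX) ys.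
(* Otherwise [B] would contain the whole component of [P], and the sink given by [U_open] would have
   an in-neighbour in both [X] and [Z]. *)
have [r0 [y0 [r0B r0y0 y0X]]] : exists r y, [/\ r \in B, D r y & ~~ (ins y \subset X)].
  have [/exists_inP[r rB /existsP[y /andP[ry yX]]]|] :=
    boolP [exists r in B, exists y, D r y && ~~ (ins y \subset X)]; first by exists r, y.
  move=> /exists_inPn noout; have inX x s : x \in B -> D x s -> ins s \subset X.
    move=> xB xs; have := noout x xB; rewrite negb_exists => /forallP/(_ s).
    by rewrite xs negbK.
  have [y [s [Py ys]]] := U_open PU (X_full (subsetP sBX P PB)).
  have yB : y \in B.
    case/connectP: Py => p; elim: p P PB {PU} => [|w p IHp] x xB /=; first by move=> _ ->.
    case/andP=> /and3P[_ _ /conflictP[_ [t [_ xt wt]]]] pp e; apply: (IHp w) => //.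
    apply: (Bins x w t) => //; apply: (subsetP XT); apply: (subsetP (inX x t xB xt)).
    by rewrite inE.
  rewrite -setI_eq0 => /set0Pn[z]; rewrite in_setI => /andP[zs zZ].
  have /X_full/andP[/andP[]] := subsetP (inX y s yB ys) z zs.
  by rewrite zZ.
have split_out x s : x \in B -> D x s -> ~~ (ins s \subset X) ->
    exists y z, [/\ y != z, y != x, z != x, ins s = [set x; y; z] & (y \in X) && (z \notin X)].
  move=> xB xs /subsetPn[z zs zX]; have xX := subsetP sBX x xB.
  have [_ s3] := fullP (X_full xX) xs.
  have xi : x \in ins s by rewrite inE.
  have [y [w [yw yx wx E]]] := cards3P xi s3.
  have zx : z != x by apply: contraNneq zX => ->.
  have le1 := X_ins xX xs.
  have uniqz v : v \in ins s -> v \notin X -> v = z.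
    by move=> vs vX; apply: (card_le1_eqP le1); rewrite inE ?vX ?zX.
  move: zs; rewrite E !inE (negbTE zx) /= => /orP[] /eqP e; subst z.
    exists w, y; rewrite eq_sym; split=> //; first by rewrite setUAC.
    rewrite zX andbT; apply: contraT => wX; have := uniqz w; rewrite E !inE eqxx !orbT.
    by move=> /(_ isT wX) e; rewrite e eqxx in yw.
  exists y, w; split=> //; rewrite zX andbT; apply: contraT => yX.
  have := uniqz y; rewrite E !inE eqxx !orbT.
  by move=> /(_ isT yX) e; rewrite e eqxx in yw.
(* Exactly two in-neighbours of [y0] are in [X], and at most one of them is in [U]; the other one is
   [r]. *)
have [r [r' [z [rB ry0 rU [r'r zr E0 zX]]]]] : exists r r' z,
    [/\ r \in B, D r y0, r \notin U & [/\ r' != r, z != r, ins y0 = [set r; r'; z] & z \notin X]].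
  have [y [z [yz yr0 zr0 E /andP[yX zX]]]] := split_out r0 y0 r0B r0y0 y0X.
  have [r0U|r0U] := boolP (r0 \in U); last by exists r0, y, z.
  have yy0 : D y y0 by have : y \in ins y0 by [rewrite E !inE eqxx orbT]; rewrite inE.
  exists y, r0, z; split=> //; first by apply: Bins r0B r0y0 (subsetP XT y yX) yy0.
    by apply: contra yr0 => yU; rewrite (U_inj yU r0U).
  by split; rewrite // 1?eq_sym // E (setUC [set r0]).
have [w [y0w Er rw]] := outsB r y0 rB ry0.
have notT x s v : x \in B -> D x s -> v \in ins s -> v \notin X -> v \notin T.
  move=> xB xs; rewrite inE => vs vX.
  rewrite !inE (negbTE vX) orbF; apply/negP=> /andP[fv /negP]; apply.
  have xX := subsetP sBX x xB; have [sS _] := fullP (X_full xX) xs.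
  apply: full_conflict (X_full xX) fv (conflict_at sS xs vs _).
  by apply: contraNneq vX => <-.
have ins3 x s : x \in B -> D x s -> #|ins s| = 3.
  by move=> xB xs; case: (fullP (X_full (subsetP sBX x xB)) xs).
(* Of the three conflicts that [x] needs, [s] supplies only [x'], so [s'] must supply two new
   ones. *)
have tight x s s' x' v : x \in B -> outs x = [set s; s'] -> D x s -> D x s' ->
    ins s = [set x; x'; v] -> x' != x -> v \notin X ->
    ins s' \subset X /\ x' \notin ins s'.
  move=> xB Ex xs xs' Es x'x vX.
  have vT : v \notin T by apply: (notT x s) => //; rewrite Es !inE eqxx !orbT.
  have xi : x \in ins s' by rewrite inE.
  have sub : conflictT T x \subset x' |: ((ins s' :\ x) :&: T).
    apply: subset_trans (confsub x s s' xB Ex) _; apply/subsetP=> y.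
    case/setD1P=> yx /setIP[yy yT]; apply/setU1P.
    case/setUP: yy => yy; last by right; rewrite in_setI in_setD1 yx yy.
    move: yy; rewrite Es -setUA !in_setU1 in_set1 (negbTE yx) /= => /orP[/eqP|/eqP e]; first by left.
    by rewrite e (negbTE vT) in yT.
  have card2 : #|ins s' :\ x| = 2.
    by move: (ins3 x s' xB xs'); rewrite (cardsD1 x) xi add1n => -[].
  split; last first.
    apply/negP=> x's'; case: (big x _ xB sub); rewrite -card2; apply: subset_leq_card.
    by rewrite subUset sub1set in_setD1 x'x x's' subsetIl.
  apply: contraT => /subsetPn[y ys' yX]; case: (big x _ xB sub).
  have yx : y != x by apply: contraNneq yX => ->; apply: (subsetP sBX).
  have yT := notT x s' y xB xs' ys' yX.
  apply: leq_trans (leq_card_setU _ _) _; rewrite cards1 add1n ltnS.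
  have <- : #|(ins s' :\ x) :\ y| = 1.
    by move: card2; rewrite (cardsD1 y) in_setD1 yx ys' add1n => -[].
  apply: subset_leq_card; apply/subsetP=> u /setIP[us uT]; rewrite in_setD1 us andbT.
  by apply: contraNneq yT => <-.
have ri : r \in ins w by rewrite inE.
have w3 := ins3 r w rB rw.
have [wX r'w] := tight r y0 w r' z rB Er ry0 rw E0 r'r zX.
have [q [q' [qq' qr q'r Ew]]] := cards3P ri w3.
(* Each [q] outside [U] must share its other out-neighbour with the element of
   [U], otherwise it could be removed from [X]. *)
have key p p' : p \in ins w -> p != r -> p' \in ins w -> p' != r -> p != p' ->
    p \notin U -> exists P t, [/\ P \in U, P \in B, D P t, D p t &
      [/\ t != w, ~~ (ins t \subset X), P != r & P != p']].
  move=> pw pr p'w p'r pp' pU.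
  have iX v : v \in ins w -> v \in X by move/(subsetP wX).
  have iB v : v \in ins w -> v \in B.
    move=> vw; apply: (Bins r v w) => //; last by rewrite inE in vw.
    exact: subsetP XT v (iX v vw).
  have Dp : D p w by rewrite inE in pw.
  have [t [wt Ep pt]] := outsB p w (iB p pw) Dp.
  have Ew' : ins w = [set p; r; p'].
    have : [set p; r; p'] \subset ins w by rewrite !subUset !sub1set pw ri p'w.
    move=> h; apply/esym/eqP; rewrite eqEcard h w3.
    rewrite -setUA cardsU1 cards2 !inE negb_or pr pp' [r == p']eq_sym p'r //.
  have only x s : x \in [set p] -> D x s -> (s == w) || (s == t).
    rewrite inE => /eqP-> ps; have: s \in outs p by rewrite inE.
    by rewrite Ep !inE.
  (* If [ins t] lies in [X], removing [p] alone gives count 1 at both [w] and [t]. *)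
  have [tX|tX] := boolP (ins t \subset X).
    case: (@X_remove [set p]).
    - by rewrite sub1set iX.
    - by apply/set0Pn; exists p; rewrite inE.
    - by rewrite disjoints1.
    have one s : p \in ins s -> ins s \subset X -> #|ins s :\: (X :\ p)| = 1.
      move=> ps sX; rewrite -(cards1 p); congr #|pred_of_set _|.
      apply/setP=> y; rewrite !inE negb_and negbK; have [->|yp] := eqVneq y p.
        by rewrite inE in ps; rewrite ps.
      apply/negP=> /andP[yX ys]; have /(subsetP sX) : y \in ins s by rewrite inE.
      by rewrite (negbTE yX).
    by move=> x s xp xs; case/orP: (only x s xp xs) => /eqP->; rewrite one // inE.
  have [p2 [z' [p2z p2p zp Et /andP[p2X zX']]]] := split_out p t (iB p pw) pt tX.
  have pX := iX p pw.
  have p2t : D p2 t by have : p2 \in ins t by [rewrite Et !inE eqxx orbT]; rewrite inE.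
  have p2B : p2 \in B by apply: Bins pt (subsetP XT p2 p2X) p2t; apply: iB.
  have sub_p : conflictT T p \subset [set r; p'; p2].
    apply: subset_trans (confsub p w t (iB p pw) Ep) _; apply/subsetP=> y.
    case/setD1P=> yp /setIP[yy yT].
    have yz : y != z' by apply: contraTneq yT => ->; rewrite (notT p t) ?iB // Et !inE eqxx !orbT.
    move: yy; rewrite Ew' Et !inE (negbTE yp) (negbTE yz) /= orbF -orbA.
    by case/or3P=> ->; rewrite ?orbT.
  have p2_in : p2 \notin [set r; p'].
    apply/negP=> h; case: (big p [set r; p'] (iB p pw)); last by rewrite cards2; case: (_ != _).
    by apply: subset_trans sub_p _; rewrite subUset subxx sub1set h.
  move: p2_in; rewrite !inE negb_or => /andP[p2r p2p'].
  have [p2U|p2U] := boolP (p2 \in U).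
    by exists p2, t; split=> //; split=> //; rewrite eq_sym.
  have [t2 [tt2 Ep2 p2t2]] := outsB p2 t p2B p2t.
  have Et' : ins t = [set p2; p; z'] by rewrite Et (setUC [set p]).
  have pp2 : p != p2 by rewrite eq_sym.
  have [t2X pt2] := tight p2 t t2 p z' p2B Ep2 p2t p2t2 Et' pp2 zX'.
  have p2w : p2 \notin ins w by rewrite Ew' !inE !negb_or p2p p2r p2p'.
  (* Removing both gives count 3 at the common sink [t], and count 1 at [w] and [t2], since [p2]
     does not enter [w] and [p] does not enter [t2]. *)
  case: (@X_remove [set p; p2]).
  - by rewrite subUset !sub1set pX.
  - by apply/set0Pn; exists p; rewrite !inE eqxx.
  - by rewrite disjoints_subset subUset !sub1set !in_setC pU.
  have one v s : v \in [set p; p2] -> v \in ins s -> ins s \subset X ->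
      (forall v', v' \in [set p; p2] -> v' \in ins s -> v' = v) ->
      #|ins s :\: (X :\: [set p; p2])| = 1.
    move=> vQ vs sX vu; rewrite -(cards1 v); congr #|pred_of_set _|.
    apply/setP=> y; rewrite in_setD in_setD in_set1 negb_and negbK; have [->|yv] := eqVneq y v.
      by rewrite vQ vs.
    apply/negP=> /andP[/orP[yQ ys|yX ys]]; first by rewrite (vu y) ?eqxx in yv.
    by rewrite (subsetP sX y ys) in yX.
  move=> x s; rewrite in_set2 => /orP[] /eqP->.
  - move=> ps; have: s \in outs p by rewrite inE.
    rewrite Ep in_set2 => /orP[] /eqP->.
      rewrite (one p) ?in_set2 ?eqxx // => v'; rewrite in_set2 => /orP[/eqP->//|/eqP->].
      by rewrite (negbTE p2w).
    rewrite (_ : _ :\: _ = ins t) ?(ins3 p t) ?iB //; apply/setP=> y.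
    rewrite in_setD in_setD in_set2 Et !inE; case: (y == p); case: (y == p2); rewrite ?andbF ?andbT //=.
    by case: eqVneq => [->|]; rewrite ?andbF // zX'.
  - move=> ps; have: s \in outs p2 by rewrite inE.
    rewrite Ep2 in_set2 => /orP[] /eqP->.
      rewrite (_ : _ :\: _ = ins t) ?(ins3 p t) ?iB //; apply/setP=> y.
      rewrite in_setD in_setD in_set2 Et !inE; case: (y == p); case: (y == p2); rewrite ?andbF ?andbT //=.
      by case: eqVneq => [->|]; rewrite ?andbF // zX'.
    rewrite (one p2) ?in_set2 ?eqxx ?orbT //; first by rewrite inE.
    by move=> v'; rewrite in_set2 => /orP[/eqP->|/eqP->//]; rewrite (negbTE pt2).
have qw : q \in ins w by rewrite Ew !inE eqxx orbT.
have q'w : q' \in ins w by rewrite Ew !inE eqxx !orbT.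
have q'q : q' != q by rewrite eq_sym.
have [qU|qU] := boolP (q \in U).
  have q'U : q' \notin U by apply: contra qq' => q'U; rewrite (U_inj qU q'U).
  have [Q [t [QU _ _ _ [_ _ _]]]] := key q' q q'w q'r qw qr q'q q'U.
  by rewrite (U_inj QU qU) eqxx.
have [q'U|q'U] := boolP (q' \in U).
  have [Q [t [QU _ _ _ [_ _ _]]]] := key q q' qw qr q'w q'r qq' qU.
  by rewrite (U_inj QU q'U) eqxx.
(* Both [q] and [q'] share a sink with the element [Q] of [U]. These two sinks are distinct and each
   has an in-neighbour outside [X], so [q] and [q'] are the only conflicts of [Q]: one too few. *)
have [Q [t [QU QB Qt qt [tw tX Qr Qq']]]] := key q q' qw qr q'w q'r qq' qU.
have [Q1 [t' [Q1U _ Q1t' q't' [t'w t'X _ Qq]]]] := key q' q q'w q'r qw qr q'q q'U.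
have e := U_inj Q1U QU; subst Q1.
have out_ins s p v : p \in B -> D p s -> ~~ (ins s \subset X) -> v \in B -> D v s ->
    v != p -> (ins s :&: T) :\ p \subset [set v].
  move=> pB ps sX vB vs vp; have [y [x [yx yp xp Es /andP[yX xX]]]] := split_out p s pB ps sX.
  have xT : x \notin T by apply: (notT p s) => //; rewrite Es !inE eqxx !orbT.
  have vy : v = y.
    have : v \in ins s by rewrite inE.
    rewrite Es !inE (negbTE vp) /= => /orP[/eqP//|/eqP e].
    by rewrite -e (subsetP sBX v vB) in xX.
  apply/subsetP=> u /setD1P[up /setIP[us uT]]; rewrite inE vy.
  move: us; rewrite Es !inE (negbTE up) /= => /orP[//|/eqP e].
  by rewrite e (negbTE xT) in uT.
have qB : q \in B by apply: (Bins r q w) => //; [apply: (subsetP XT); apply: (subsetP wX) | rewrite inE in qw].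
have q'B : q' \in B by apply: (Bins r q' w) => //; [apply: (subsetP XT); apply: (subsetP wX) | rewrite inE in q'w].
have qQ : q != Q by rewrite eq_sym.
have q'Q : q' != Q by rewrite eq_sym.
have sub_t := out_ins t Q q QB Qt tX qB qt qQ.
have sub_t' := out_ins t' Q q' QB Q1t' t'X q'B q't' q'Q.
have [s [ts EQ Qs]] := outsB Q t QB Qt.
have : t' \in outs Q by rewrite inE.
rewrite EQ in_set2 => /orP[] /eqP e; subst.
  have : q' \in (ins t :&: T) :\ Q.
    by rewrite in_setD1 q'Q in_setI inE q't' (subsetP BT).
  by move/(subsetP sub_t); rewrite inE (negbTE q'q).
case: (big Q [set q; q'] QB); last by rewrite cards2 qq'.
apply: subset_trans (confsub Q t _ QB EQ) _; apply/subsetP=> y.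
case/setD1P=> yQ /setIP[/setUP[yt|yt] yT]; rewrite in_set2.
  have /(subsetP sub_t) : y \in (ins t :&: T) :\ Q by rewrite in_setD1 yQ in_setI yt.
  by rewrite inE => ->.
have /(subsetP sub_t') : y \in (ins s :&: T) :\ Q by rewrite in_setD1 yQ in_setI yt.
by rewrite inE => ->; rewrite orbT.
Qed.

Lemma good_minimal :
  exists c : V -> 'I_4, good Z ord0 c /\ forall x, x \in U -> c x != ord0.
Proof.
have Tns z : z \in T -> z \notin Z /\ ~~ sink z.
  rewrite !inE => /orP[/andP[/andP[]]//|/X_full/andP[/andP[]//]].
have notT x : x \notin T -> x \notin Z -> ~~ sink x -> full x.
  by rewrite !inE negb_or negb_and negbK /free => /andP[/orP[|//] nf _] xZ xS; rewrite xZ xS in nf.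
apply: (@core_good T cp) => //.
- move=> B sBT B0 Bcl.
  have [sBX|/subsetPn[x xB xX]] := boolP (B \subset X); first exact: min_root.
  have := subsetP sBT x xB; rewrite !inE (negbTE xX) orbF => /andP[_ nfx].
  apply: (tot_root _ _ _ sBT Bcl xB nfx) => // y.
    by move/Tns/andP.
  by move=> /andP[yZ yS] yT; apply: notT.
- by move=> x s xT xZ xs; apply: (fullP _ xs); apply: notT (arc_nsink xs).
- move=> x s sS xT xs; split=> //.
  have [xX|xX] := boolP (x \in X).
    apply: leq_trans (X_ins xX xs); apply: subset_leq_card; apply/subsetP=> y.
    by rewrite !inE negb_or => /andP[/andP[_ ->] ->].
  move: xT; rewrite !inE (negbTE xX) orbF => /andP[fx nfx].
  apply: leq_trans (insZ sS); apply: subset_leq_card; apply/subsetP=> y.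
  rewrite in_setD in_setI => /andP[yT ys]; rewrite ys /=; rewrite inE in ys.
  apply: contraR (nfx) => yZ; have fy := notT y yT yZ (arc_nsink ys).
  have yx : y != x by apply: contraNneq yT => ->; rewrite !inE fx nfx.
  exact: full_conflict fy fx (conflict_at sS ys xs yx).
- move=> s sS dis.
  have [sZ|/subsetPn[x xs xZ]] := boolP (ins s \subset Z).
    by left; rewrite -(setIidPl sZ) insZ.
  have xs' : D x s by rewrite inE in xs.
  have fx := notT x (negbT (disjointFr dis xs)) xZ (arc_nsink xs').
  by right; have [_ s3] := fullP fx xs'.
- move=> x xU xT; have [xZ xS] := U_out xU; have fx := notT x xT xZ xS.
  have xX : x \in X by case/and3P: thinX => _ /subsetP-> //; rewrite !inE xU fx.
  by rewrite !inE xX orbT in xT.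
Qed.

End Minimal.

(** By [insZ] the set [full_set] itself is thin, so a minimal thin set is available when
    [good_closed] does not apply. *)
Lemma good_exists :
  exists c : V -> 'I_4, good Z ord0 c /\ forall x, x \in U -> c x != ord0.
Proof.
have [/exists_inP[P PU /andP[fP /forallP h]]|/exists_inPn h] := boolP [exists P in U,
    full P && [forall y, forall s, connect link P y ==> D y s ==> [disjoint ins s & Z]]].
  apply: (good_closed PU fP) => y s Py ys.
  by have := implyP (implyP (forallP (h y) s) Py) ys.
have thinF : thin full_set.
  rewrite /thin subxx subsetIr /=; apply/forallP=> s; apply/implyP=> /andP[sS].
  case/set0Pn=> x; rewrite !inE => /andP[xs fx].
  by have := insZ sS; rewrite -(full_ins fx xs); case: #|_| => [|[|]].
have [X minX _] := minset_exists thinF.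
apply: (good_minimal minX) => P PU fP; have := h P PU; rewrite fP /= negb_forall.
case/existsP=> y; rewrite negb_forall => /existsP[s].
by rewrite !negb_imply => /and3P[]; exists y, s.
Qed.

End Digraph.

(** * Irregular edge-colorings from colorings of the centers *)

Section EdgeColor.
Variables (V : finType) (T : eqType) (e : rel V) (col : V -> V -> T).

Definition cdeg i x := #|[set y | e x y & col x y == i]|.

Definition irregular_coloring :=
  (forall x y, col x y = col y x) /\
  (forall x y, e x y -> cdeg (col x y) x != cdeg (col x y) y).

End EdgeColor.

Section ArcColor.
Variables (V : finType) (D : rel V) (c : V -> 'I_4).
Hypothesis asymD : forall x y, D x y -> ~~ D y x.

Definition arc_col x y := if D x y then c x else if D y x then c y else ord0.

Lemma arc_colC x y : arc_col x y = arc_col y x.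
Proof.
rewrite /arc_col; case: (boolP (D x y)) => [/asymD/negbTE->|] //.
Qed.

Lemma cdeg_arc e i x : (forall x y, e x y = D x y || D y x) ->
  cdeg e arc_col i x = (c x == i) * #|outs D x| + #|[set w in ins D x | c w == i]|.
Proof.
move=> eD; rewrite /cdeg -(cardsID (outs D x)); congr (_ + _).
  case: eqVneq => [cx|cx]; rewrite ?mul1n ?mul0n.
    congr #|pred_of_set _|; apply/setP=> y; rewrite !inE eD /arc_col.
    by case: (D x y); rewrite ?andbF //= cx eqxx.
  apply/eqP; rewrite cards_eq0; apply/eqP/setP=> y; rewrite !inE eD /arc_col.
  by case: (D x y); rewrite ?andbF //= (negbTE cx).
congr #|pred_of_set _|; apply/setP=> y; rewrite !inE eD /arc_col.
by case: (boolP (D x y)) => [/asymD/negbTE->|_] //=; case: ifP.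
Qed.

End ArcColor.

(** * Removing monochromatic paths through centers *)

Section Repaint.
Variables (V : finType) (D : rel V) (Z H : {set V}) (k : 'I_4).
Hypothesis asymD : forall x y, D x y -> ~~ D y x.
Hypothesis degD : forall x, #|outs D x| + #|ins D x| <= 3.
Hypothesis outsD : forall x, x \notin H -> ~~ sink D x -> #|outs D x| = 2.
Hypothesis nsinkZ : forall z, z \in Z -> ~~ sink D z.
Hypothesis HZ : H \subset Z.
Hypothesis H_deg : forall h, h \in H -> #|outs D h| + #|ins D h| = 3.
Hypothesis H_ins : forall h, h \in H -> ins D h \subset Z.
Hypothesis H_outs : forall h y, h \in H -> D h y -> y \notin Z.
Hypothesis ZZ : forall z z', z \in Z -> D z z' -> z' \in Z -> z' \in H.

(* The vertices of [H] have degree 3 in color [k]. *)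
Definition good_hot (c : V -> 'I_4) := good D Z k c /\
  forall h y, h \in H -> D h y -> if sink D y then rainbow D c y else c y != k.

Lemma rainbow_eq (c c' : V -> 'I_4) s : {in ins D s, c =1 c'} -> rainbow D c s -> rainbow D c' s.
Proof. by move=> cc' /rainbowP inj; apply/rainbowP=> x y xs ys; rewrite -!cc' //; apply: inj. Qed.

Lemma monochrome_eq (c c' : V -> 'I_4) s :
  {in ins D s, c =1 c'} -> monochrome D c s -> monochrome D c' s.
Proof.
move=> cc' /monochromeP[s3 eqc]; apply/monochromeP; split=> // x y xs ys.
by rewrite -!cc' //; apply: eqc.
Qed.

Definition mono_arcs (c : V -> 'I_4) :=
  [set p : V * V | [&& D p.1 p.2, ~~ sink D p.2 & c p.1 == c p.2]].

(** With out-degree 2, [x] has [w] as its only in-neighbour. The new color avoids [c x], shared by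
    [w] and [y], and at most two colors at the other out-neighbour [y']: three of four. Then no arc
    between [x] and another center is monochromatic. The path itself shows that neither [x] nor [y]
    is pinned. *)
Lemma repaint_step (c : V -> 'I_4) w x y : good_hot c ->
  D w x -> D x y -> x \notin Z -> y \notin Z -> ~~ sink D y -> c w = c x -> c x = c y ->
  exists2 c', good_hot c' & #|mono_arcs c'| < #|mono_arcs c|.
Proof.
move=> [[cZ cS cL] cH] wx xy xZ yZ yS cwx cxy.
have xH : x \notin H by apply: contra xZ; apply: (subsetP HZ).
have o2 := outsD xH (arc_nsink xy).
have [y' yy' Ex] : exists2 y', y != y' & outs D x = [set y; y'].
  have /eqP/cards2P[a [b [ab E]]] := o2; have: y \in outs D x by rewrite inE.
  rewrite E !inE => /orP[] /eqP e; subst y; first by exists b.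
  by exists a; rewrite 1?eq_sym // setUC.
have xy' : D x y' by have : y' \in outs D x by [rewrite Ex !inE eqxx orbT]; rewrite inE.
have onlyxs s : D x s -> s != y -> s = y'.
  by move=> xs /negbTE sy; have : s \in outs D x by [rewrite inE]; rewrite Ex !inE sy => /eqP.
have insx v : D v x -> v = w.
  move=> vx; have : #|ins D x| <= 1 by move: (degD x); rewrite o2 -[3]/(2 + 1) leq_add2l.
  by move/card_le1_eqP; apply; rewrite inE.
have xnl : ~~ pinned D c Z x.
  apply/negP=> xl; have := cL w x wx xl; rewrite negb_and xZ orbT => /(_ isT).
  by rewrite cwx eqxx.
have ynl : ~~ pinned D c Z y.
  apply/negP=> yl; have := cL x y xy yl; rewrite negb_and xZ => /(_ isT).
  by rewrite cxy eqxx.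
pose F := c x |: (if sink D y' then c @: (ins D y' :\ x) else [set c y']).
have [g gF] : exists g, g \notin F.
  have ltF : #|F| < 4.
    rewrite ltnS; apply: leq_trans (leq_card_setU _ _) _.
    rewrite cards1 -[3]/(1 + 2) leq_add2l; case: ifP => _; last by rewrite cards1.
    apply: leq_trans (leq_imset_card _ _) _.
    have xi : x \in ins D y' by rewrite inE.
    by move: (leq_trans (leq_addl _ _) (degD y')); rewrite (cardsD1 x) xi add1n ltnS.
  apply/existsP; apply: contraTT ltF; rewrite negb_exists -leqNgt => /forallP h.
  rewrite -{1}(card_ord 4) -cardsT subset_leq_card //; apply/subsetP=> i _.
  by have := h i; rewrite negbK.
have gx : g != c x by apply: contraNneq gF => ->; rewrite !inE eqxx.
have gy' : ~~ sink D y' -> g != c y'.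
  by move=> /negbTE S; apply: contraNneq gF => ->; rewrite /F S !inE eqxx orbT.
have gins v : sink D y' -> D v y' -> v != x -> g != c v.
  move=> S vy' vx; apply: contraNneq gF => ->; rewrite /F S; apply/setU1P; right.
  by apply: imset_f; rewrite !inE vx.
pose c' v := if v == x then g else c v.
have c'x : c' x = g by rewrite /c' eqxx.
have c'N v : v != x -> c' v = c v by rewrite /c' => /negbTE->.
have noty s : sink D s -> D x s -> s = y'.
  by move=> sS xs; apply: onlyxs xs _; apply: contraNneq yS => <-.
have c'ins s : ~~ D x s -> {in ins D s, c =1 c'}.
  by move=> xs v; rewrite inE => vs; rewrite c'N //; apply: contraNneq xs => <-.
have rain s : sink D s -> D x s -> rainbow D c' s.
  move=> sS xs; have e := noty s sS xs; subst s.
  have : rainbow D c y'.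
    case/orP: (cS y' sS) => // m; case/negP: xnl; rewrite /pinned (negbTE xZ) /=.
    by apply/existsP; exists y'; rewrite xs sS.
  move/rainbowP=> inj; apply/rainbowP=> u v; rewrite !inE => uy' vy'.
  have [->|ux] := eqVneq u x; have [->|vx] := eqVneq v x => //.
  - by rewrite c'x c'N // => e; have := gins v sS vy' vx; rewrite e eqxx.
  - by rewrite c'x c'N // => e; have := gins u sS uy' ux; rewrite e eqxx.
  by rewrite !c'N //; apply: inj; rewrite inE.
exists c'.
  split; first split.
  - by move=> z zZ; rewrite c'N ?cZ //; apply: contraNneq xZ => <-.
  - move=> s sS; have [xs|xs] := boolP (D x s); first by rewrite rain.
    by case/orP: (cS s sS) => [/(rainbow_eq (c'ins s xs))->|/(monochrome_eq (c'ins s xs))->];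
      rewrite ?orbT.
  - move=> u a ua al uaZ.
    (* Sinks below [x] are rainbow for [c'], so recoloring creates no new pinned vertex. *)
    have [acl ax] : pinned D c Z a /\ a != x.
      case/orP: al => [aZ|/existsP[s /and3P[as_ sS m]]].
        by rewrite /pinned aZ; split=> //; apply: contraNneq xZ => <-.
      have xs : ~~ D x s by apply: contraL m => xs; apply/rainbow_not_monochrome/rain.
      split; last by apply: contraNneq xs => <-.
      apply/orP; right; apply/existsP; exists s; rewrite as_ sS /=.
      by apply: monochrome_eq m => v vs; rewrite (c'ins s xs v vs).
    rewrite (c'N a ax); have [e|ux] := eqVneq u x; last by rewrite c'N // cL.
    subst u; rewrite c'x; have ay : a != y by apply: contraNneq ynl => <-.
    have aS : ~~ sink D a.
      case/orP: acl => [/nsinkZ//|/existsP[s /and3P[as_ _ _]]]; exact: arc_nsink as_.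
    by have e := onlyxs a ua ay; subst a; apply: gy'.
  move=> h s hH hs; have hZ := subsetP HZ h hH.
  have sx : s != x.
    apply/eqP=> e; subst s; have := cH h x hH hs; rewrite (negbTE (arc_nsink xy)).
    by rewrite -cwx -(insx h hs) cZ // eqxx.
  have := cH h s hH hs; case: ifP => sS; last by rewrite c'N.
  have [xs _|xs] := boolP (D x s); first exact: rain.
  exact: rainbow_eq (c'ins s xs).
apply: proper_card; apply/properP; split; last first.
  exists (w, x); rewrite !inE /= wx (arc_nsink xy) /= ?cwx ?eqxx //.
  have wx' : w != x by apply: contraTneq wx => ->; apply/negP=> h; move: (asymD h); rewrite h.
  by rewrite c'x c'N // cwx eq_sym.
apply/subsetP=> -[u v]; rewrite !inE /= => /and3P[uv vS]; rewrite uv vS /=.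
have [e|vx] := eqVneq v x.
  subst v; have e := insx u uv; subst u.
  have wx' : w != x by apply: contraTneq wx => ->; apply/negP=> h; move: (asymD h); rewrite h.
  by rewrite c'x c'N // cwx eq_sym (negbTE gx).
rewrite (c'N v vx); have [e|ux] := eqVneq u x; last by rewrite c'N.
subst u; rewrite c'x; have [->|vy] := eqVneq v y; first by rewrite -cxy (negbTE gx).
by have e := onlyxs v uv vy; subst v; rewrite (negbTE (gy' vS)).
Qed.

Lemma repaint (c : V -> 'I_4) : good_hot c -> exists2 c', good_hot c' &
  forall w x y, D w x -> D x y -> x \notin Z -> y \notin Z -> ~~ sink D y ->
    c' w = c' x -> c' x <> c' y.
Proof.
have [n] := ubnP #|mono_arcs c|; elim: n c => // n IHn c lt cG.
pose bad := [exists w, exists x, exists y, [&& D w x, D x y, x \notin Z, y \notin Z,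
  ~~ sink D y, c w == c x & c x == c y]].
have [/existsP[w /existsP[x /existsP[y]]]|nbad] := boolP bad.
  case/and4P=> wx xy xZ /and4P[yZ yS /eqP cwx /eqP cxy].
  have [c' c'G lt'] := repaint_step cG wx xy xZ yZ yS cwx cxy.
  by apply: (IHn c') => //; apply: leq_trans lt' lt.
exists c => // w x y wx xy xZ yZ yS cwx cxy; case/negP: nbad.
apply/existsP; exists w; apply/existsP; exists x; apply/existsP; exists y.
by rewrite wx xy xZ yZ yS cwx cxy eqxx.
Qed.

(** In the color of an arc its tail has degree 3 in [H], 2 in the rest of [Z], and 2 or 3 elsewhere.
    The head has degree 1 or 3, and 3 only if it is a monochrome sink, in [H], or a center of the
    same color; in each of these cases the tail has degree 2. *)
Lemma irregular_of_good_hot e (c : V -> 'I_4) :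
  (forall x y, e x y = D x y || D y x) -> good_hot c ->
  exists col : V -> V -> 'I_4, irregular_coloring e col.
Proof.
move=> eD /repaint[{}c [[cZ cS cL] cH] cP].
exists (arc_col D c); split; first exact: arc_colC.
suff key x y : D x y -> cdeg e (arc_col D c) (c x) x != cdeg e (arc_col D c) (c x) y.
  move=> x y; rewrite eD => /orP[xy|yx]; first by have := key x y xy; rewrite /arc_col xy.
  by have := key y x yx; rewrite eq_sym arc_colC // /arc_col yx.
move=> xy; rewrite !cdeg_arc // eqxx mul1n; have xS := arc_nsink xy.
set m := #|[set w in ins D x | c w == c x]|; set n := #|[set w in ins D y | c w == c x]|.
have xy' : x \in ins D y by rewrite inE.
have ins_le1 v : v \notin H -> ~~ sink D v -> #|ins D v| <= 1.
  by move=> vH vS; move: (degD v); rewrite (outsD vH vS) -[3]/(2 + 1) leq_add2l.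
have n_gt0 : 0 < n by apply/card_gt0P; exists x; rewrite !inE xy eqxx.
have n_le : n <= #|ins D y| by apply: subset_leq_card; apply/subsetP=> w /setIdP[].
have m_le : m <= #|ins D x| by apply: subset_leq_card; apply/subsetP=> w /setIdP[].
have n_sink : sink D y -> rainbow D c y /\ n = 1 \/ monochrome D c y /\ n = 3.
  move=> yS; case/orP: (cS y yS) => [r|mo]; [left | right]; split=> //.
    apply/eqP; rewrite eqn_leq n_gt0 andbT; apply/card_le1_eqP=> u v.
    rewrite inE => /andP[uy /eqP cu]; rewrite inE => /andP[vy /eqP cv].
    by apply: (rainbowP _ _ _ r); rewrite // cu cv.
  have [s3 eqc] := monochromeP _ _ _ mo; transitivity #|ins D y|; last exact: s3.
  congr #|pred_of_set _|; apply/setP=> u.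
  rewrite inE; case: (boolP (u \in ins D y)) => //= uy; by rewrite (eqc u x) ?eqxx.
have o0 : sink D y -> #|outs D y| = 0 by move/eqP->; rewrite cards0.
have n1 : y \notin H -> ~~ sink D y -> n = 1.
  move=> yH yS; apply/eqP; rewrite eqn_leq n_gt0 andbT.
  exact: leq_trans n_le (ins_le1 y yH yS).
have all_ins h : h \in H -> #|[set w in ins D h | c w == k]| = #|ins D h|.
  move=> hH; congr #|pred_of_set _|; apply/setP=> u; rewrite inE.
  by case: (boolP (u \in ins D h)) => //= /(subsetP (H_ins hH))/cZ->; rewrite eqxx.
have [xH|xH] := boolP (x \in H).
  have cx := cZ x (subsetP HZ x xH).
  rewrite /m cx all_ins // H_deg //; have := cH x y xH xy; have yZ := H_outs xH xy.
  have yH : y \notin H by apply: contra yZ; apply: (subsetP HZ).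
  case: ifPn => [yS r|yS cy]; last by rewrite (negbTE cy) n1.
  case: (n_sink yS) => [[_ ->]|[mo _]]; first by rewrite o0 ?muln0.
  by have := rainbow_not_monochrome r; rewrite mo.
rewrite (outsD xH xS); have [xZ|xZ] := boolP (x \in Z).
  have cx := cZ x xZ; have -> : m = 0.
    apply/eqP; rewrite cards_eq0; apply/eqP/setP=> w; rewrite !inE.
    apply/negP=> /andP[wx /eqP cwx]; have wZ : w \notin Z.
      by apply: contra xH => wZ; apply: ZZ wx xZ.
    by have := cL w x wx; rewrite /pinned xZ (negbTE wZ) cwx eqxx => /(_ isT isT).
  have [yH|yH] := boolP (y \in H).
    by rewrite /n cx cZ ?(subsetP HZ) // eqxx mul1n all_ins // H_deg.
  have [yS|yS] := boolP (sink D y).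
    by case: (n_sink yS) => -[_ ->]; rewrite o0 // muln0.
  by rewrite n1 // (outsD yH yS); case: (c y == c x).
have insx1 := ins_le1 x xH xS.
have [yS|yS] := boolP (sink D y).
  case: (n_sink yS) => -[mo ->]; rewrite o0 // muln0 //.
  suff -> : m = 0 by [].
  apply/eqP; rewrite cards_eq0; apply/eqP/setP=> w; rewrite !inE.
  apply/negP=> /andP[wx]; apply/negP; apply: (cL w x wx); last by rewrite (negbTE xZ) andbF.
  by apply/orP; right; apply/existsP; exists y; rewrite xy yS.
have [yZ|yZ] := boolP (y \in Z).
  have yH : y \notin H by apply: contra xZ => yH; apply: (subsetP (H_ins yH)).
  have := cL x y xy; rewrite /pinned yZ (negbTE xZ) eq_sym => /(_ isT isT)/negbTE->.
  by rewrite mul0n n1.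
have yH : y \notin H by apply: contra yZ; apply: (subsetP HZ).
rewrite n1 // (outsD yH yS); have [cyx|] := eqVneq (c y) (c x); last by [].
suff -> : m = 0 by [].
apply/eqP; rewrite cards_eq0; apply/eqP/setP=> w; rewrite !inE.
by apply/negP=> /andP[wx /eqP cwx]; apply: (cP w x y).
Qed.

End Repaint.

(** * A single vertex of odd out-degree *)

Section Existence.
Variables (V : finType) (D e : rel V).
Hypothesis eD : forall x y, e x y = D x y || D y x.
Hypothesis asymD : forall x y, D x y -> ~~ D y x.
Hypothesis degD : forall x, #|outs D x| + #|ins D x| <= 3.

Lemma irrD x : D x x = false.
Proof. by apply/negP=> xx; have := asymD xx; rewrite xx. Qed.

Lemma even_colorable :
  (forall x, ~~ sink D x -> #|outs D x| = 2) ->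
  exists col : V -> V -> 'I_4, irregular_coloring e col.
Proof.
move=> even.
have [||||||c [cG _]] := @good_exists V D set0 set0 degD.
- by move=> x _; apply: even.
- by move=> z; rewrite inE.
- by move=> s _; rewrite setI0 cards0.
- by move=> x y; rewrite inE.
- by move=> x; rewrite inE.
- by move=> z a; rewrite inE.
apply: (@irregular_of_good_hot V D set0 set0 ord0 asymD degD _ _ _ _ _ _ _ e c eD).
- by move=> x _; apply: even.
- by move=> z; rewrite inE.
- exact: sub0set.
- by move=> h; rewrite inE.
- by move=> h; rewrite inE.
- by move=> h y; rewrite inE.
- by move=> z z'; rewrite inE.
by split=> // h y; rewrite inE.
Qed.

(** Color 0 on [v], [d1], [d2] gives color degree 3 at [v] and 2 at [d1] and [d2]. The end [u] of
    the short leg must keep color degree 1, which is the purpose of [U]. *)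
Lemma spider_colorable v u d1 d2 :
  outs D v = [set u] -> ins D v = [set d1; d2] -> d1 != d2 ->
  (forall x, x != v -> ~~ sink D x -> #|outs D x| = 2) ->
  (forall d a, d \in ins D v -> D d a -> a != v -> sink D a /\ a != u) ->
  (forall a, D d1 a -> D d2 a -> a = v) ->
  exists col : V -> V -> 'I_4, irregular_coloring e col.
Proof.
move=> ov iv d12 even dout dcommon.
have vu : D v u by have : u \in outs D v by [rewrite ov inE]; rewrite inE.
have vout a : D v a -> a = u.
  by move=> va; have : a \in outs D v by [rewrite inE]; rewrite ov inE => /eqP.
have vS : ~~ sink D v := arc_nsink vu.
have dv d : d \in [set d1; d2] -> D d v by rewrite -iv inE.
have d1v : D d1 v by apply: dv; rewrite !inE eqxx.
have d2v : D d2 v by apply: dv; rewrite !inE eqxx orbT.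
pose Z := [set v; d1; d2].
have ZE z : (z \in Z) = (z == v) || (z \in ins D v).
  by rewrite iv !inE orbA.
have vZ : v \in Z by rewrite ZE eqxx.
have uN : u \notin ins D v by rewrite inE; apply: asymD.
have uv : u != v by apply: contraTneq vu => ->; rewrite irrD.
have uZ : u \notin Z by rewrite ZE negb_or uv.
have nsinkZ z : z \in Z -> ~~ sink D z.
  by rewrite ZE => /orP[/eqP->//|]; rewrite inE => /arc_nsink.
have insZ s : sink D s -> #|ins D s :&: Z| <= 1.
  move=> sS; have sv : s != v by apply: contraTneq sS => ->.
  apply/card_le1_eqP=> x y; rewrite !in_setI !ZE => /andP[]; rewrite inE => xs xZ.
  case/andP; rewrite inE => ys yZ; case/orP: xZ => [/eqP ex|dx]; case/orP: yZ => [/eqP ey|dy].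
  - by rewrite ex ey.
  - by subst x; have [_] := dout y s dy ys sv; rewrite (vout s xs) eqxx.
  - by subst y; have [_] := dout x s dx xs sv; rewrite (vout s ys) eqxx.
  move: dx dy; rewrite iv !inE => /orP[] /eqP ex /orP[] /eqP ey; subst x y => //.
    by rewrite (dcommon s) ?eqxx in sv.
  by rewrite (dcommon s) ?eqxx in sv.
(* If [u] is a center, it must avoid 0 itself. If it is a sink with three in-neighbours, banning 0
   from a second one prevents a monochrome [u]; a sink with fewer in-neighbours is never
   monochrome. *)
have [U [U1 UP Uu Umono]] : exists U : {set V},
    [/\ forall x y, x \in U -> y \in U -> x = y,
        forall x, x \in U -> x \notin Z /\ ~~ sink D x,
        sink D u || (u \in U) &
        sink D u -> #|ins D u| = 3 -> exists2 x, x \in U & D x u].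
  have [uS|uS] := boolP (sink D u); last first.
    exists [set u]; split.
    - by move=> x y; rewrite !inE => /eqP-> /eqP->.
    - by move=> x; rewrite inE => /eqP->.
    - by rewrite inE eqxx.
    by [].
  have [u3|u3] := eqVneq #|ins D u| 3; last first.
    exists set0; split; first by move=> x y; rewrite inE.
    - by move=> x; rewrite inE.
    - by [].
    by move=> _ /eqP; rewrite (negbTE u3).
  have vi : v \in ins D u by rewrite inE.
  have [P PE] : exists P, P \in ins D u :\ v.
    by apply/set0Pn; rewrite -card_gt0; move: u3; rewrite (cardsD1 v) vi add1n => -[->].
  move: PE; rewrite !inE => /andP[Pv Pu].
  exists [set P]; split=> //.
  - by move=> x y; rewrite !inE => /eqP-> /eqP->.
  - move=> x; rewrite inE => /eqP->; split; last exact: arc_nsink Pu.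
    rewrite ZE negb_or Pv; apply/negP=> Pi; have [_] := dout P u Pi Pu uv.
    by rewrite eqxx.
  by exists P; rewrite ?inE.
have [||||||c [cG cU]] := @good_exists V D Z U degD.
- by move=> x xZ; apply: even; apply: contraNneq xZ => ->.
- exact: nsinkZ.
- exact: insZ.
- exact: U1.
- exact: UP.
- move=> z a; rewrite ZE => /orP[/eqP->|zi] za aZ; first by rewrite (vout a za).
  by have [|->//] := dout z a zi za; apply: contraNneq aZ => ->.
apply: (@irregular_of_good_hot V D Z [set v] ord0 asymD degD _ _ _ _ _ _ _ e c eD).
- by move=> x; rewrite inE => xv; apply: even.
- exact: nsinkZ.
- by rewrite sub1set.
- by move=> h; rewrite inE => /eqP->; rewrite ov iv cards1 cards2 d12.
- by move=> h; rewrite inE => /eqP->; apply/subsetP=> x xv; rewrite ZE xv orbT.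
- by move=> h y; rewrite inE => /eqP-> /vout->.
- move=> z z'; rewrite ZE => /orP[/eqP->|zi] zz' z'Z.
    by rewrite (vout z' zz') (negbTE uZ) in z'Z.
  rewrite inE; apply: contraT => z'v; have [z'S _] := dout z z' zi zz' z'v.
  by have := nsinkZ z' z'Z; rewrite z'S.
split=> // h y; rewrite inE => /eqP-> /vout->; case: cG => cZ cS _.
case: ifPn => uS; last by apply: cU; rewrite (negbTE uS) in Uu.
case/orP: (cS u uS) => // /monochromeP[u3 eqc].
have [x xU xu] := Umono uS u3; have := cU x xU.
by rewrite (eqc x v) ?inE // (cZ v vZ).
Qed.

(* Next to the claw at [v], such a [d] has at most two conflicts apart from [v], so
   it can be colored after a color for the claw has been chosen. *)
Definition soft_arc v d :=
  [exists y, exists d', exists a, [&& D v y, sink D y, D d y, D d' y, d != v, d' != v,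
    d != d', D d a, a != y & ~~ sink D a || D d' a]].

(** Deleting the arcs leaving [v] and [S] gives an even orientation, colored by [c1]. Each
    out-neighbour of [v] then forbids at most one color for the claw: its own if it is a center,
    else that of its at most one remaining in-neighbour. So a fourth color [k] is left. Each vertex
    of [S] finally avoids [k] and at most two more vertices. *)
Lemma claw_colorable v :
  #|outs D v| = 3 -> (forall x, x != v -> ~~ sink D x -> #|outs D x| = 2) ->
  (forall y, D v y -> sink D y -> #|ins D y| = 3 ->
     exists2 d, D d y & soft_arc v d) ->
  exists col : V -> V -> 'I_4, irregular_coloring e col.
Proof.
move=> ov even soft.
have iv x : D x v = false.
  have := degD v; rewrite ov -{2}[3]addn0 leq_add2l leqn0 cards_eq0 => /eqP/setP/(_ x).
  by rewrite !inE.
pose S := [set d | soft_arc v d].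
have vS : v \notin S.
  rewrite inE; apply/negP=> /existsP[y /existsP[d' /existsP[a]]].
  by case/and5P=> _ _ _ _ /andP[]; rewrite eqxx.
pose D' x y := [&& x != v, x \notin S & D x y].
have D'sub x y : D' x y -> D x y by case/and3P.
have outs' x : x != v -> x \notin S -> outs D' x = outs D x.
  by move=> xv xS; apply/setP=> y; rewrite !inE /D' xv xS.
have nsink' x : ~~ sink D' x -> [/\ x != v, x \notin S & ~~ sink D x].
  by case/set0Pn=> y; rewrite inE => /and3P[xv xS /arc_nsink].
have sink' x : sink D x -> sink D' x.
  by move=> xS; apply: contraT => /nsink'[_ _]; rewrite xS.
have ins' x : ins D' x \subset ins D x.
  by apply/subsetP=> y; rewrite !inE => /D'sub.
have [|||||||c1 [[_ c1S c1L] _]] := @good_exists V D' set0 set0.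
- move=> x; apply: leq_trans (degD x); apply: leq_add; apply: subset_leq_card => //.
  by apply/subsetP=> y; rewrite !inE => /D'sub.
- by move=> x _ /nsink'[xv xS xN]; rewrite outs' // even.
- by move=> z; rewrite inE.
- by move=> s _; rewrite setI0 cards0.
- by move=> x y; rewrite inE.
- by move=> x; rewrite inE.
- by move=> z a; rewrite inE.
pose Fy y := if sink D y then ins D' y else [set y].
pose F := \bigcup_(y in outs D v) Fy y.
have Fy1 y : y \in outs D v -> #|Fy y| <= 1.
  rewrite inE => vy; rewrite /Fy; case: ifPn => yS; last by rewrite cards1.
  have vi : v \in ins D y by rewrite inE.
  have sub : ins D' y \subset ins D y :\ v.
    by apply/subsetP=> x; rewrite !inE => /and3P[-> _ ->].
  have [y3|y3] := eqVneq #|ins D y| 3.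
    have [d dy dS] := soft y vy yS y3.
    have dv : d != v by apply: contraNneq vS => <-; rewrite inE.
    have di : d \in ins D y :\ v by rewrite !inE dv.
    suff <- : #|(ins D y :\ v) :\ d| = 1.
      apply: subset_leq_card; apply/subsetP=> x xi; rewrite in_setD1 (subsetP sub) // andbT.
      by move: xi; rewrite inE => /and3P[_ xS _]; apply: contraNneq xS => ->; rewrite inE.
    by move: y3; rewrite (cardsD1 v) vi add1n (cardsD1 d) di add1n => -[].
  apply: leq_trans (subset_leq_card sub) _.
  have : #|ins D y| < 3 by rewrite ltn_neqAle y3 (leq_trans _ (degD y)) // leq_addl.
  by rewrite (cardsD1 v) vi add1n !ltnS.
have F3 : #|F| <= 3.
  rewrite -ov /F -[leqRHS]sum1_card; apply: leq_trans (_ : \sum_(y in outs D v) #|Fy y| <= _); last exact: leq_sum.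
  apply: (big_ind2 (fun (A : {set V}) n => #|A| <= n)) => //; first by rewrite cards0.
  by move=> A1 n1 A2 n2 h1 h2; apply: leq_trans (leq_card_setU _ _) (leq_add h1 h2).
have [k kF] : exists k, k \notin c1 @: F.
  have ltF : #|c1 @: F| < 4 by rewrite ltnS (leq_trans (leq_imset_card _ _)).
  apply/existsP; apply: contraTT ltF; rewrite negb_exists -leqNgt => /forallP h.
  rewrite -{1}(card_ord 4) -cardsT subset_leq_card //; apply/subsetP=> i _.
  by have := h i; rewrite negbK.
have kF' x : x \in F -> c1 x != k by move=> xF; apply: contraNneq kF => <-; apply: imset_f.
pose W d := [set x | (conflict D d x && (x != v)) || (D d x && ~~ sink D x)].
have W2 d : d \in S -> #|W d| <= 2.
  rewrite inE => /existsP[y /existsP[d' /existsP[a]]].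
  case/and5P=> vy yS dy d'y /and5P[dv d'v dd' da /andP[ay bad]].
  have od : outs D d = [set y; a].
    have : [set y; a] \subset outs D d by rewrite subUset !sub1set !inE dy.
    move=> h; apply/esym/eqP; rewrite eqEcard h even ?(arc_nsink dy) //.
    by rewrite cards2 eq_sym ay.
  have iy : ins D y = [set v; d; d'].
    have h : [set v; d; d'] \subset ins D y by rewrite !subUset !sub1set !inE vy dy.
    apply/esym/eqP; rewrite eqEcard h (leq_trans (leq_trans (leq_addl _ _) (degD y))) //.
    by rewrite -setUA cardsU1 cards2 !inE negb_or ![v == _]eq_sym dv d'v dd'.
  pose R := if sink D a then (ins D a :\ d) :\ d' else [set a].
  have R1 : #|R| <= 1.
    rewrite /R; case: ifPn => aS; last by rewrite cards1.
    rewrite aS /= in bad; have := leq_trans (leq_addl _ _) (degD a).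
    by rewrite (cardsD1 d) inE da (cardsD1 d') !inE bad eq_sym dd' !add1n !ltnS.
  have sub : W d \subset d' |: R.
    apply/subsetP=> x; rewrite in_set => /orP[/andP[/conflictP[dx [s [sS ds xs]]] xv]|/andP[dx xS]].
      have : s \in outs D d by rewrite inE.
      rewrite od !inE => /orP[] /eqP es; subst s.
        have : x \in ins D y by rewrite inE.
        by rewrite iy !inE (negbTE xv) [x == d]eq_sym (negbTE dx) /= => ->.
      by rewrite /R sS !inE xs [x == d]eq_sym dx !andbT orbN.
    have : x \in outs D d by rewrite inE.
    rewrite od !inE => /orP[] /eqP ex; subst x; first by rewrite yS in xS.
    by rewrite /R (negbTE xS) inE eqxx orbT.
  apply: leq_trans (subset_leq_card sub) _.
  by apply: leq_trans (leq_card_setU _ _) _; rewrite cards1 -[2]/(1 + 1) leq_add2l.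
pose X d := k |: c1 @: (W d :\: S).
have [|c2 [c2X c2L]] := @list_coloring V 'I_4 ord0 _ X S (conflict_sym D).
  move=> B sBS /set0Pn[d dB]; exists d => //; have dS := subsetP sBS d dB.
  rewrite card_ord; apply: (@leq_ltn_trans (1 + #|W d|)); last by rewrite ltnS -[3]/(1 + 2) leq_add2l W2.
  rewrite -(cardsID S (W d)) [_ + #|_ :\: _|]addnC addnA leq_add //.
    apply: leq_trans (leq_card_setU _ _) _; rewrite cards1 leq_add2l; exact: leq_imset_card.
  apply: subset_leq_card; apply/subsetP=> x; rewrite !in_set => /andP[xB dx].
  have xS := subsetP sBS x xB; rewrite dx; rewrite inE in xS; rewrite xS andbT orbC.
  by rewrite (contraNneq _ vS) ?orbT // => <-; rewrite inE.
pose c x := if x == v then k else if x \in S then c2 x else c1 x.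
have cv : c v = k by rewrite /c eqxx.
have cSE x : x \in S -> c x = c2 x.
  by move=> xS; rewrite /c xS; case: eqVneq => // xv; rewrite -xv xS in vS.
have cE x : x != v -> x \notin S -> c x = c1 x.
  by rewrite /c => /negbTE-> /negbTE->.
have c2k x : x \in S -> c2 x != k.
  by move=> xS; apply: contraNneq (c2X x xS) => ->; rewrite !inE eqxx.
have c2W x y : x \in S -> y \in W x -> y \notin S -> c2 x != c1 y.
  move=> xS yW yS; apply: contraNneq (c2X x xS) => ->; rewrite in_setU; apply/orP; right.
  by apply: imset_f; rewrite in_setD yS.
have sinkF s x : D v s -> sink D s -> D' x s -> x \in F.
  move=> vs sS xs; apply/bigcupP; exists s; first by rewrite inE.
  by rewrite /Fy sS inE.
(* Having lost an in-neighbour, [s] has fewer than three in [D'], so [c1] is rainbow on those that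
   remain. *)
have touched s t : sink D s -> D t s -> (t == v) || (t \in S) -> rainbow D c s.
  move=> sS ts tS.
  have vcase x : D v s -> D x s -> x != v -> c x != k.
    move=> vs xs xv; have [xS|xS] := boolP (x \in S); first by rewrite cSE // c2k.
    by rewrite cE // kF' // (sinkF s) // /D' xv xS.
  have key x x' : D x s -> D x' s -> x != x' -> c x != c x'.
    move=> xs x's xx'.
    have [e1|xv] := eqVneq x v; first by subst x; rewrite cv eq_sym vcase // eq_sym.
    have [e1|x'v] := eqVneq x' v; first by subst x'; rewrite cv vcase.
    have [xS|xS] := boolP (x \in S); have [x'S|x'S] := boolP (x' \in S).
    - by rewrite !cSE // c2L // (conflict_at sS).
    - by rewrite cSE // cE // c2W // inE (conflict_at sS) // x'v.
    - by rewrite cE // cSE // eq_sym c2W // inE (conflict_at sS) ?xv // eq_sym.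
    rewrite !cE //; have x1 : x \in ins D' s by rewrite inE /D' xv xS.
    have x2 : x' \in ins D' s by rewrite inE /D' x'v x'S.
    case/orP: (c1S s (sink' s sS)) => [/rainbowP inj|/monochromeP[s3 _]].
      by apply: contra_neq xx'; apply: inj.
    have : t \notin ins D' s by rewrite inE /D'; case/orP: tS => ->; rewrite ?andbF.
    have E : ins D' s = ins D s.
      by apply/eqP; rewrite eqEcard ins' s3 (leq_trans (leq_addl _ _) (degD s)).
    by rewrite E inE ts.
  apply/rainbowP=> x x'; rewrite !inE => xs x's; apply: contra_eq; exact: key.
have insE s : ~~ D v s -> (forall t, t \in S -> ~~ D t s) -> ins D' s = ins D s.
  move=> vs Ss; apply/setP=> x; rewrite !inE /D'; case: (boolP (D x s)) => xs; rewrite ?andbF //.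
  rewrite andbT; apply/andP; split; first by apply: contraNneq vs => <-.
  by apply: contraL xs; apply: Ss.
have untouched s : sink D s -> ~~ rainbow D c s ->
    [/\ ins D' s = ins D s & {in ins D s, c =1 c1}].
  move=> sS nr.
  have no t : (t == v) || (t \in S) -> ~~ D t s.
    by move=> tS; apply: contra nr => ts; apply: touched ts tS.
  split; first by apply: insE => [|t tS]; apply: no; rewrite ?eqxx ?tS ?orbT.
  move=> x; rewrite inE => xs; have : ~~ ((x == v) || (x \in S)) by apply: contraL xs; apply: no.
  by rewrite negb_or => /andP[xv xS]; rewrite cE.
apply: (@irregular_of_good_hot V D [set v] [set v] k asymD degD _ _ _ _ _ _ _ e c eD).
- by move=> x; rewrite inE => xv; apply: even.
- by move=> z; rewrite inE => /eqP->; rewrite /sink -card_gt0 ov.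
- exact: subxx.
- by move=> h; rewrite inE => /eqP->; rewrite ov (_ : ins D v = set0) ?cards0 //;
    apply/setP=> x; rewrite !inE iv.
- by move=> h; rewrite inE => /eqP->; apply/subsetP=> x; rewrite !inE iv.
- by move=> h y; rewrite inE => /eqP-> vy; rewrite inE; apply: contraTneq vy => ->; rewrite iv.
- by move=> z z' _ zz'; rewrite inE => /eqP ez; rewrite ez iv in zz'.
split; first split.
- by move=> z; rewrite inE => /eqP->.
- move=> s sS; have [//|nr] := boolP (rainbow D c s).
  have [insE' cc1] := untouched s sS nr.
  case/orP: (c1S s (sink' s sS)) => m.
    have := rainbowP _ _ _ m; rewrite insE' => inj; case/negP: nr.
    by apply/rainbowP=> x y xs ys; rewrite !cc1 //; apply: inj.
  have := monochromeP _ _ _ m; rewrite insE' => -[s3 eqc].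
  by apply/monochromeP; split=> // x y xs ys; rewrite !cc1 //; apply: eqc.
- move=> x a xa pa _.
  have av : a != v by apply: contraTneq xa => ->; rewrite iv.
  move: pa; rewrite /pinned inE (negbTE av) /= => /existsP[s /and3P[as_ sS m]].
  have nr : ~~ rainbow D c s by apply: contraL m; apply: rainbow_not_monochrome.
  have [insE' cc1] := untouched s sS nr.
  have aS : a \notin S by apply: contra nr => aS; apply: touched as_ _; rewrite ?aS ?orbT.
  have aN := arc_nsink as_.
  have m1 : monochrome D' c1 s.
    have [s3 eqc] := monochromeP _ _ _ m.
    by apply/monochromeP; rewrite insE'; split=> // y z ys zs; rewrite -!cc1 //; apply: eqc.
  have pa : pinned D' c1 set0 a.
    apply/orP; right; apply/existsP; exists s; rewrite m1 sink' // andbT /D' av aS.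
    by rewrite as_.
  rewrite (cE a av aS); have [e1|xv] := eqVneq x v.
    subst x; rewrite cv eq_sym kF' //; apply/bigcupP; exists a; first by rewrite inE.
    by rewrite /Fy (negbTE aN) inE.
  have [xS|xS] := boolP (x \in S).
    by rewrite cSE // c2W // inE xa aN orbT.
  by rewrite cE //; apply: c1L pa _; rewrite ?inE // /D' xv xS.
move=> h y; rewrite inE => /eqP-> vy; case: ifPn => yS; first by apply: touched vy _; rewrite ?eqxx.
have yv : y != v by apply: contraTneq vy => ->; rewrite iv.
have [yS'|yS'] := boolP (y \in S); first by rewrite cSE // c2k.
rewrite cE // kF' //; apply/bigcupP; exists y; first by rewrite inE.
by rewrite /Fy (negbTE yS) inE.
Qed.

End Existence.

(** * Reversing edges around a single odd vertex *)

Section Flip.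
Variables (V : finType) (e : rel V).
Hypothesis irr_e : irreflexive e.

Definition orientation (D : rel V) :=
  (forall x y, e x y = D x y || D y x) /\ (forall x y, D x y -> ~~ D y x).

Definition odd_out (D : rel V) x := odd #|outs D x|.

Definition flip a b (D : rel V) : rel V := fun x y =>
  if ((x == a) && (y == b)) || ((x == b) && (y == a)) then D y x else D x y.

Lemma flip_ab a b D : flip a b D a b = D b a.
Proof. by rewrite /flip !eqxx. Qed.

Lemma flip_ba a b D : flip a b D b a = D a b.
Proof. by rewrite /flip !eqxx orbT. Qed.

Lemma flip_neql a b D x y : x != a -> x != b -> flip a b D x y = D x y.
Proof. by rewrite /flip => /negbTE-> /negbTE->. Qed.

Lemma flip_neqr a b D x y : y != a -> y != b -> flip a b D x y = D x y.
Proof. by rewrite /flip => /negbTE-> /negbTE->; rewrite !andbF. Qed.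

Lemma flip_orientation a b D : orientation D -> orientation (flip a b D).
Proof.
move=> [eD asD]; split=> x y; rewrite /flip.
  rewrite eD; case: (x == a); case: (x == b); case: (y == a); case: (y == b) => //=; exact: orbC.
by case: (x == a); case: (x == b); case: (y == a); case: (y == b) => //=; apply: asD.
Qed.

Lemma odd_flip a b D x : orientation D -> e a b ->
  odd_out (flip a b D) x = odd_out D x (+) (x == a) (+) (x == b).
Proof.
move=> [eD asD] eab; have ab : a != b by apply: contraTneq eab => ->; rewrite irr_e.
rewrite /odd_out; have [xa|xa] := eqVneq x a; last have [xb|xb] := eqVneq x b.
- subst x; rewrite (negbTE ab) addbF addbT; have [Dab|Dab] := boolP (D a b).
    rewrite [#|outs D a|](cardsD1 b) inE Dab oddD addTb negbK; congr (odd #|pred_of_set _|).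
    apply/setP=> y; rewrite !inE /flip eqxx (negbTE ab) /= orbF.
    by case: eqVneq => [->|]; rewrite ?(negbTE (asD a b Dab)).
  rewrite [#|outs (flip a b D) a|](cardsD1 b) inE flip_ab.
  have -> : D b a by move: eab; rewrite eD (negbTE Dab).
  rewrite oddD addTb; congr (~~ odd #|pred_of_set _|).
  apply/setP=> y; rewrite !inE /flip eqxx (negbTE ab) /= orbF.
  by case: eqVneq => [->|]; rewrite ?(negbTE Dab).
- subst x; rewrite addbF addbT; have [Dba|Dba] := boolP (D b a).
    rewrite [#|outs D b|](cardsD1 a) inE Dba oddD addTb negbK; congr (odd #|pred_of_set _|).
    apply/setP=> y; rewrite !inE /flip eqxx (negbTE xa) /=.
    by case: eqVneq => [->|]; rewrite ?(negbTE (asD b a Dba)).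
  rewrite [#|outs (flip a b D) b|](cardsD1 a) inE flip_ba.
  have -> : D a b by move: eab; rewrite eD (negbTE Dba) orbF.
  rewrite oddD addTb; congr (~~ odd #|pred_of_set _|).
  apply/setP=> y; rewrite !inE /flip eqxx (negbTE xa) /=.
  by case: eqVneq => [->|]; rewrite ?(negbTE Dba).
rewrite !addbF; congr (odd #|pred_of_set _|); apply/setP=> y.
by rewrite !inE flip_neql.
Qed.

Lemma card_outs_ins D x : orientation D ->
  #|outs D x| + #|ins D x| = #|[set y | e x y]|.
Proof.
move=> [eD asD]; rewrite -(cardsID (outs D x) [set y | e x y]); congr (_ + _).
  by congr #|pred_of_set _|; apply/setP=> y; rewrite !inE eD; case: (D x y); rewrite ?andbF.
congr #|pred_of_set _|; apply/setP=> y; rewrite !inE eD.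
by case: (boolP (D x y)) => // /asD/negbTE->.
Qed.

Hypothesis deg_e : forall x, #|[set y | e x y]| <= 3.

Lemma orientation_deg D x : orientation D -> #|outs D x| + #|ins D x| <= 3.
Proof. by move/card_outs_ins->. Qed.

Lemma even_outs D x : orientation D -> ~~ odd_out D x -> ~~ sink D x -> #|outs D x| = 2.
Proof.
move=> oD; rewrite /odd_out /sink -cards_eq0.
have := leq_trans (leq_addr _ _) (orientation_deg x oD).
by case: #|_| => [|[|[|[|n]]]].
Qed.

(** If a sink [y] below [v] has three in-neighbours and none of them is soft, then the further
    out-neighbours of [d1] and [d2] are sinks and not shared: exactly the long legs of a tree at
    [y]. Reversing the arc from [v] to [y] moves the odd vertex to [y], with out-degree 1. *)
Lemma colorable_of_claw D v : orientation D -> 1 < #|outs D v| ->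
  (forall x, odd_out D x = (x == v)) ->
  exists col : V -> V -> 'I_4, irregular_coloring e col.
Proof.
move=> oD ov odds; have [eD asD] := oD.
have degD x := orientation_deg x oD.
have {}ov : #|outs D v| = 3.
  move: ov (odds v) (leq_trans (leq_addr _ _) (degD v)); rewrite eqxx /odd_out.
  by case: #|_| => [|[|[|[|n]]]].
have even x : x != v -> ~~ sink D x -> #|outs D x| = 2.
  by move=> xv; apply: even_outs; rewrite ?odds.
have iv x : D x v = false.
  have := degD v; rewrite ov -{2}[3]addn0 leq_add2l leqn0 cards_eq0 => /eqP/setP/(_ x).
  by rewrite !inE.
have [/forallP soft|] := boolP [forall y, [&& D v y, sink D y & #|ins D y| == 3] ==>
    [exists d, D d y && soft_arc D v d]].
  apply: (claw_colorable eD asD degD ov even) => y vy yS y3.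
  have /existsP[d /andP[dy ds]] : [exists d, D d y && soft_arc D v d].
    by apply: (implyP (soft y)); rewrite vy yS y3.
  by exists d.
rewrite negb_forall => /existsP[y]; rewrite negb_imply => /andP[/and3P[vy yS /eqP y3]].
rewrite negb_exists => /forallP hard.
have vi : v \in ins D y by rewrite inE.
have yv : y != v by apply: contraTneq vy => ->; rewrite iv.
have y0 x : D y x = false by move/eqP/setP/(_ x): yS; rewrite !inE.
have [d1 [d2 [d12 d1v d2v iy]]] := cards3P vi y3.
have d1y : D d1 y by have : d1 \in ins D y by [rewrite iy !inE eqxx orbT]; rewrite inE.
have d2y : D d2 y by have : d2 \in ins D y by [rewrite iy !inE eqxx !orbT]; rewrite inE.
have yd d : D d y -> d != y by apply: contraTneq => ->; rewrite y0.
have hard' d d' a : D d y -> D d' y -> d != v -> d' != v -> d != d' ->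
    D d a -> a != y -> sink D a /\ ~~ D d' a.
  move=> dy d'y dv d'v dd' da ay; apply/andP; rewrite -[_ && _]negbK.
  apply: contra (hard d) => bad; rewrite dy; apply/existsP; exists y; apply/existsP; exists d'.
  by apply/existsP; exists a; rewrite vy yS dy d'y dv d'v dd' da ay -[~~ _ || _]negbK negb_or negbK.
pose D1 := flip v y D.
have oD1 : orientation D1 by apply: flip_orientation.
have D1E x z : x != v -> x != y -> D1 x z = D x z by apply: flip_neql.
have ins1 : ins D1 y = [set d1; d2].
  apply/setP=> x; rewrite inE; have [->|xv] := eqVneq x v.
    by rewrite /D1 flip_ab y0 !inE ![v == _]eq_sym (negbTE d1v) (negbTE d2v).
  have [->|xy] := eqVneq x y.
    by rewrite (irrD oD1.2) !inE ![y == _]eq_sym (negbTE (yd _ d1y)) (negbTE (yd _ d2y)).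
  by rewrite D1E //; move/setP/(_ x): iy; rewrite !inE (negbTE xv).
have evy : e v y by rewrite eD vy.
apply: (@spider_colorable V D1 e oD1.1 oD1.2 (fun x => orientation_deg x oD1) y v d1 d2).
- apply/setP=> x; rewrite !inE; have [->|xv] := eqVneq x v; first by rewrite /D1 flip_ba.
  have [->|xy] := eqVneq x y; first by rewrite (irrD oD1.2).
  by rewrite /D1 flip_neqr // y0.
- exact: ins1.
- exact: d12.
- move=> x xy; apply: even_outs oD1 _; rewrite odd_flip // odds (negbTE xy).
  by case: (x == v).
- move=> d a; rewrite ins1 => di da ay.
  have dv : d != v by move: di; rewrite !inE => /orP[] /eqP->.
  have dy : D d y by move: di; rewrite !inE => /orP[] /eqP->.
  rewrite D1E ?yd // in da; have av : a != v by apply: contraTneq da => ->; rewrite iv.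
  split=> //; have aS : sink D a.
    move: di; rewrite !inE => /orP[] /eqP ed; subst d.
      by case: (hard' d1 d2 a).
    by case: (hard' d2 d1 a); rewrite // eq_sym.
  rewrite /sink -(eqP aS); apply/eqP/setP=> z; by rewrite !inE D1E.
move=> a; rewrite !D1E ?yd // => d1a d2a; apply/eqP; apply: contraT => ay.
by have [_] := hard' d1 d2 a d1y d2y d1v d2v d12 d1a ay; rewrite d2a.
Qed.

(* A vertex of odd out-degree is harmless if it has degree 3 and is not part of
   a triangle oriented transitively with it as the middle vertex. *)
Definition special (D : rel V) v :=
  #|[set y | e v y]| = 3 /\ forall u d, D v u -> D d v -> ~~ D d u.

(** If [u], or an out-neighbour other than [v] of [d1] or [d2], is a center, reversing the edges
    leading there from [v] makes it a claw. A long leg ending in [u] is excluded by [special]. *)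
Lemma colorable_of_special D v : orientation D -> special D v ->
  (forall x, odd_out D x = (x == v)) ->
  exists col : V -> V -> 'I_4, irregular_coloring e col.
Proof.
move=> oD [v3 spec] odds; have [eD asD] := oD.
have [|ov] := ltnP 1 #|outs D v|; first by move/colorable_of_claw; apply.
have {}ov : #|outs D v| = 1.
  by move: ov (odds v); rewrite eqxx /odd_out; case: #|_| => [|[|n]].
have iv : #|ins D v| = 2 by move: (card_outs_ins v oD); rewrite ov v3 => -[].
have /eqP/cards1P[u ovE] := ov.
have /eqP/cards2P[d1 [d2 [d12 ivE]]] := iv.
have vu : D v u by have : u \in outs D v by [rewrite ovE inE]; rewrite inE.
have d1v : D d1 v by have : d1 \in ins D v by [rewrite ivE !inE eqxx]; rewrite inE.
have d2v : D d2 v by have : d2 \in ins D v by [rewrite ivE !inE eqxx orbT]; rewrite inE.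
have neq x y : D x y -> x != y by apply: contraTneq => ->; rewrite (irrD asD).
have even x : x != v -> ~~ sink D x -> #|outs D x| = 2.
  by move=> xv; apply: even_outs; rewrite ?odds.
have edge x y : D x y -> e x y by rewrite eD => ->.
have uv : u != v by rewrite eq_sym neq.
have [uS|uS] := boolP (sink D u); last first.
  apply: (@colorable_of_claw (flip v u D) u); first exact: flip_orientation.
    rewrite -(even u uv uS) subset_leq_card //; apply/subsetP=> x; rewrite !inE => ux.
    rewrite flip_neqr //; last by rewrite eq_sym neq.
    by apply: contraTneq ux => ->; apply: asD.
  by move=> x; rewrite odd_flip ?edge // odds addbb addFb.
have [/existsP[d /existsP[a /and4P[dv da av aS]]]|] :=
  boolP [exists d, exists a, [&& D d v, D d a, a != v & ~~ sink D a]].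
  apply: (@colorable_of_claw (flip d a (flip v d D)) a).
  - by do 2!apply: flip_orientation.
  - rewrite -(even a av aS) subset_leq_card //; apply/subsetP=> x; rewrite !inE => ax.
    have xa : x != a by rewrite eq_sym neq.
    have xd : x != d by apply: contraTneq ax => ->; apply: asD.
    have ad : a != d by rewrite eq_sym neq.
    by rewrite flip_neqr // flip_neql.
  have evd : e v d by rewrite eD dv orbT.
  move=> x; rewrite odd_flip ?edge //; last exact: flip_orientation.
  by rewrite odd_flip // odds addbb addFb addbb addFb.
move/existsPn=> nsk.
have dsink d a : D d v -> D d a -> a != v -> sink D a.
  move=> dv da av; apply: contraT => aS; have /existsPn/(_ a) := nsk d.
  by rewrite dv da av aS.
have ud1 : u != d1 by apply: contraTneq uS => ->; apply: arc_nsink d1v.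
have ud2 : u != d2 by apply: contraTneq uS => ->; apply: arc_nsink d2v.
have [/existsP[a /and3P[d1a d2a av]]|/existsPn ncommon] :=
  boolP [exists a, [&& D d1 a, D d2 a & a != v]].
  (* Reversing the 4-cycle through [v], [d1], [a], [d2] preserves all parities and raises the
     out-degree of [v] from 1 to 3. *)
  pose D1 := flip v d1 D; pose D2 := flip v d2 D1; pose D3 := flip a d1 D2.
  have o1 : orientation D1 by apply: flip_orientation.
  have o2 : orientation D2 by apply: flip_orientation.
  have o3 : orientation D3 by apply: flip_orientation.
  have [vd1 vd2] : v != d1 /\ v != d2 by rewrite ![v == _]eq_sym !neq.
  have d21 : d2 != d1 by rewrite eq_sym.
  apply: (@colorable_of_claw (flip a d2 D3) v).
  - exact: flip_orientation.
  - have va : v != a by rewrite eq_sym.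
    apply/card_gt1P; exists u, d1; split; rewrite ?inE //.
      rewrite flip_neql // /D3 flip_neql // /D2 flip_neqr //.
      by rewrite /D1 flip_neqr.
    by rewrite flip_neql // /D3 flip_neql // /D2 flip_neqr // 1?eq_sym // /D1 flip_ab.
  have ev d : D d v -> e v d by rewrite eD orbC => ->.
  have ea d : D d a -> e a d by rewrite eD orbC => ->.
  move=> x; rewrite !odd_flip ?odds ?ev ?ea //.
  by case: (x == v); case: (x == d1); case: (x == d2); case: (x == a).
apply: (@spider_colorable V D e eD asD (fun x => orientation_deg x oD) v u d1 d2) => //.
  move=> d a; rewrite inE => dv da av; split; first exact: (dsink d a).
  by apply: contraTneq da => ->; apply: spec.
move=> a d1a d2a; apply/eqP; apply: contraT => av.
by have := ncommon a; rewrite d1a d2a av.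
Qed.

End Flip.

(** * Reducing the number of vertices of odd out-degree *)

Section Merge.
Variables (V : finType) (e : rel V).
Hypothesis sym_e : symmetric e.
Hypothesis irr_e : irreflexive e.
Hypothesis deg_e : forall x, #|[set y | e x y]| <= 3.

(** Each passage through an inner vertex toggles its parity twice; for the same reason repeated
    edges of the walk do no harm. *)
Lemma flip_walk (R : rel V) D x p :
  symmetric R -> subrel R e -> orientation e D -> path R x p ->
  exists D', [/\ orientation e D', forall a b, ~~ R a b -> D' a b = D a b &
    forall z, odd_out D' z = odd_out D z (+) (z == x) (+) (z == last x p)].
Proof.
move=> symR sRe; elim: p x D => [|y p IHp] x D oD /=.
  by exists D; split=> // z; rewrite -addbA addbb addbF.
case/andP=> xy yp; have [D' [oD' D'E odd']] := IHp y _ (flip_orientation x y oD) yp.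
exists D'; split=> // [a b ab|z]; last first.
  rewrite odd' (odd_flip irr_e _ oD (sRe x y xy)).
  by rewrite -[_ (+) (z == y) (+) (z == y)]addbA addbb addbF.
rewrite D'E // /flip; case: ifP => // /orP[] /andP[/eqP ea /eqP eb]; subst a b.
  by rewrite xy in ab.
by rewrite symR xy in ab.
Qed.

(* Reversing safe edges keeps [special] at all odd vertices but [s] and [t]. *)
Definition safe D s t x y := e x y &&
  [forall r, [&& odd_out D r, r != s & r != t] ==> [&& x != r, y != r & ~~ (e x r && e y r)]].

Definition good_orientation D := [/\ orientation e D,
  forall v, odd_out D v -> special e D v &
  forall v w, odd_out D v -> odd_out D w -> e v w = false].

(** The given path is followed until a vertex is odd or has an odd neighbour [r], other than [s]. Up
    to there the edges are safe for lack of such neighbours; the final edge to [r] is safe because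
    odd vertices are pairwise nonadjacent. *)
Lemma reach_odd D s x p : good_orientation D -> path e x p ->
  odd_out D (last x p) -> last x p != s ->
  exists t, [/\ odd_out D t, t != s & connect (safe D s t) x t].
Proof.
move=> [_ _ indep]; elim: p x => [|y p IHp] x /=; first by move=> _ xo xs; exists x.
case/andP=> xy yp lo ls.
have [/andP[xo xs]|xN] := boolP (odd_out D x && (x != s)); first by exists x.
have xr r : odd_out D r -> r != s -> x != r.
  by move=> ro rs; apply: contraNneq xN => ->; rewrite ro.
have [/existsP[r /and3P[ro rs exr]]|/existsPn nr] :=
  boolP [exists r, [&& odd_out D r, r != s & e x r]].
  exists r; split=> //; apply: connect1; rewrite /safe exr /=.
  apply/forallP=> r'; apply/implyP=> /and3P[r'o r's r'r].
  by rewrite xr // eq_sym r'r negb_and (indep r r') // orbT.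
have [t [to ts yt]] := IHp y yp lo ls; exists t; split=> //.
apply: connect_trans yt; apply: connect1; rewrite /safe xy /=.
apply/forallP=> r; apply/implyP=> /and3P[ro rs _].
have exr : ~~ e x r by have := nr r; rewrite ro rs.
by rewrite xr // (negbTE exr) andbT; apply: contraNneq exr => <-.
Qed.

(** Reversing a safe walk makes [s] and [r] even. The arcs at any other odd vertex and between its
    neighbours are untouched, so it stays special. *)
Lemma merge_odd D : good_orientation D -> exists2 D', good_orientation D' &
  forall v w, odd_out D' v -> odd_out D' w -> connect e v w -> v = w.
Proof.
have [n] := ubnP #|[set v | odd_out D v]|; elim: n D => // n IHn D lt gD.
have [/existsP[s /existsP[t /and4P[so to st con]]]|/existsPn h] :=
    boolP [exists s, exists t, [&& odd_out D s, odd_out D t, s != t & connect e s t]]; last first.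
  exists D => // v w vo wo vw; apply/eqP; apply: contraT => neq.
  by have /existsPn/(_ w) := h v; rewrite vo wo neq vw.
case/connectP: con => p sp et.
have [||r [ro rs]] := @reach_odd D s s p gD sp; rewrite -?et // 1?eq_sym //.
case/connectP=> q sq er; have [oD spec indep] := gD.
have symR : symmetric (safe D s r).
  move=> x y; rewrite /safe sym_e; congr andb; apply: eq_forallb => z.
  by congr (_ ==> _); rewrite andbCA [e x z && _]andbC.
have sRe : subrel (safe D s r) e by move=> x y /andP[].
have [D' [oD' D'E odd']] := flip_walk symR sRe oD sq; rewrite -er in odd'.
have oddE z : odd_out D' z = [&& odd_out D z, z != s & z != r].
  rewrite odd'; have [->|] := eqVneq z s; first by rewrite so eq_sym (negbTE rs).
  by have [->|] := eqVneq z r; rewrite ?ro // !addbF !andbT.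
have uns v x y : odd_out D' v -> [|| x == v, y == v | e x v && e y v] -> D' x y = D x y.
  rewrite oddE => vo bad; apply: D'E; rewrite negb_and; apply/orP; right.
  rewrite negb_forall; apply/existsP; exists v; rewrite vo /=.
  by move: bad; case: eqP => //=; case: eqP => //= _ _ ->.
apply: (IHn D'); last first.
  split=> // [v vo|v w]; last first.
    by rewrite !oddE => /and3P[? _ _] /and3P[? _ _]; apply: indep.
  have [v3 sv] : special e D v by apply: spec; move: vo; rewrite oddE => /and3P[].
  have edge x y : D x y -> e x y by rewrite oD.1 => ->.
  split=> // u d; rewrite (uns v v u) ?eqxx // (uns v d v) ?eqxx ?orbT // => vu dv.
  rewrite (uns v d u) ?sv // edge // [e u v]sym_e edge // !orbT //.
rewrite -ltnS; apply: leq_trans lt; rewrite ltnS; apply: proper_card; apply/properP; split.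
  by apply/subsetP=> z; rewrite !inE oddE => /and3P[].
by exists s; rewrite !inE ?oddE ?eqxx ?andbF.
Qed.

(** The previous results allow one odd vertex in the whole graph, so each component is colored with
    all other edges deleted, and [root] selects the coloring to use. *)
Lemma component_colorable D : good_orientation D ->
  (forall v w, odd_out D v -> odd_out D w -> connect e v w -> v = w) ->
  exists col : V -> V -> 'I_4, irregular_coloring e col.
Proof.
move=> [[eD asD] spec _] uniq; have csym := sym_connect_sym sym_e.
pose er r : rel V := fun x y => e x y && connect e r x.
have con r x y : e x y -> connect e r x = connect e r y.
  by move=> xy; apply: (same_connect_r csym); apply: connect1.
have comp r : exists col : V -> V -> 'I_4, irregular_coloring (er r) col.
  pose Dr x y := D x y && connect e r x.
  have outsr x : connect e r x -> outs Dr x = outs D x.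
    by move=> rx; apply/setP=> y; rewrite !inE /Dr rx andbT.
  have oddr x : odd_out Dr x = odd_out D x && connect e r x.
    have [rx|/negbTE rx] := boolP (connect e r x); first by rewrite /odd_out outsr ?andbT.
    rewrite andbF /odd_out (_ : outs Dr x = set0) ?cards0 //.
    by apply/setP=> y; rewrite !inE /Dr rx andbF.
  have oDr : orientation (er r) Dr.
    split=> x y; rewrite /er /Dr; last by case/andP=> /asD/negbTE->.
    have [xy|/negbTE xy] := boolP (e x y); last first.
      by move: (xy); rewrite eD => /norP[/negbTE-> /negbTE->].
    by rewrite -(con r x y xy) -andb_orl -eD xy.
  have irr_er : irreflexive (er r) by move=> x; rewrite /er irr_e.
  have deg_er x : #|[set y | er r x y]| <= 3.
    apply: leq_trans (deg_e x); apply: subset_leq_card; apply/subsetP=> y.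
    by rewrite !inE => /andP[].
  have [/existsP[v vo]|/existsPn even] := boolP [exists v, odd_out Dr v].
    move: (vo); rewrite oddr => /andP[vo' rv]; have [v3 sv] := spec v vo'.
    apply: (colorable_of_special irr_er deg_er oDr (v := v)) => [|x].
      split; last by move=> u d /andP[vu _] /andP[dv _]; rewrite negb_and sv.
      rewrite -v3; congr #|pred_of_set _|; apply/setP=> y.
      by rewrite !inE /er rv andbT.
    have [->|xv] := eqVneq x v; first exact: vo.
    apply: contra_neqF xv; rewrite oddr => /andP[xo rx]; apply: uniq => //.
    by rewrite csym in rx; apply: connect_trans rx rv.
  apply: (even_colorable oDr.1 oDr.2 (fun x => orientation_deg deg_er x oDr)) => x.
  exact: (even_outs deg_er oDr (even x)).
have [f fP] := fin_all_exists comp.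
pose col x y : 'I_4 := if e x y then f (root e x) x y else ord0.
have rootE x y : e x y -> root e x = root e y.
  by move=> xy; apply/(rootP csym)/connect1.
exists col; split=> [x y|x y xy].
  rewrite /col sym_e; case: ifP => // yx; rewrite (rootE y x yx).
  by case: (fP (root e x)) => fC _; apply: fC.
have cdegE i z : cdeg e col i z = cdeg (er (root e z)) (f (root e z)) i z.
  congr #|pred_of_set _|; apply/setP=> w; rewrite !inE /er /col.
  by rewrite [connect _ _ _]csym connect_root andbT; case: ifP.
rewrite !cdegE -(rootE x y xy) {1 2}/col xy.
case: (fP (root e x)) => _; apply; by rewrite /er xy csym connect_root.
Qed.

(** * The orientation given by a locally irregular coloring *)

Section FromColoring.
Variables (T : eqType) (col : V -> V -> T).
Hypothesis colP : irregular_coloring e col.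

Let colC : forall x y, col x y = col y x := colP.1.
Definition edeg x y := cdeg e col (col x y) x.

(* An edge is centered at its end of color degree 2, if any, and otherwise at
   its end of color degree 3. *)
Definition centers x y := e x y && ((edeg x y == 2) || (edeg x y == 3) && (edeg y x == 1)).

Lemma edeg_gt0 x y : e x y -> 0 < edeg x y.
Proof. by move=> xy; apply/card_gt0P; exists y; rewrite inE xy eqxx. Qed.

Lemma edeg_le3 x y : edeg x y <= 3.
Proof.
by apply: leq_trans (deg_e x); apply: subset_leq_card; apply/subsetP=> z; rewrite !inE => /andP[].
Qed.

Lemma edeg_neq x y : e x y -> edeg x y != edeg y x.
Proof. by move=> xy; rewrite /edeg (colC y x); apply: colP.2. Qed.

Lemma edeg_sum x y z : e x y -> e x z -> col x y != col x z -> edeg x y + edeg x z <= 3.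
Proof.
move=> xy xz neq; apply: leq_trans (deg_e x).
rewrite /edeg /cdeg -cardsUI [X in _ + #|pred_of_set X|](_ : _ = set0) ?cards0 ?addn0; last first.
  apply/setP=> w; rewrite !inE; case: (e x w) => //=; apply/negP=> /andP[/eqP->].
  by rewrite (negbTE neq).
by apply: subset_leq_card; apply/subsetP=> w; rewrite !inE => /orP[] /andP[].
Qed.

(** Color degrees are between 1 and 3 and differ along an edge. Of the pairs 12, 13 and 23, each has
    exactly one center. *)
Lemma centers_orientation : orientation e centers.
Proof.
split=> x y; rewrite /centers.
  rewrite [e y x]sym_e; case: (boolP (e x y)) => //= xy.
  move: (edeg_gt0 xy) (edeg_le3 x y) (edeg_le3 y x) (edeg_neq xy).
  have yx : e y x by rewrite sym_e.
  move: (edeg_gt0 yx); case: (edeg x y) => [|[|[|[|?]]]] //; by case: (edeg y x) => [|[|[|[|?]]]].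
case/andP=> xy; move: (edeg_neq xy); rewrite [e y x]sym_e xy /=.
case: (edeg x y) => [|[|[|[|?]]]] //; by case: (edeg y x) => [|[|[|[|?]]]].
Qed.

(** Without a color of degree 3 at [v], the out-arcs have colors of degree 2; two such colors would
    need four edges, so the out-degree is 0 or 2. A color of degree 3 uses all edges at [v]. *)
Lemma odd_centers v : odd_out centers v ->
  #|[set y | e v y]| = 3 /\ forall y, e v y -> edeg v y = 3.
Proof.
move=> vo.
have [/existsP[y /andP[vy /eqP y3]]|/existsPn no3] := boolP [exists y, e v y && (edeg v y == 3)].
  have E : [set z | e v z & col v z == col v y] = [set z | e v z].
    apply/eqP; rewrite eqEcard; apply/andP; split.
      by apply/subsetP=> z; rewrite !inE => /andP[].
    by rewrite [leqRHS]y3.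
  split=> [|z vz]; first by rewrite -E.
  have : z \in [set z | e v z] by rewrite inE.
  by rewrite -E inE => /andP[_ /eqP ez]; rewrite /edeg ez.
have cE y : centers v y = e v y && (edeg v y == 2).
  rewrite /centers; case: (boolP (e v y)) => //= vy.
  by have := no3 y; rewrite vy /= => /negbTE->; rewrite orbF.
move: vo; rewrite /odd_out; have [->|/set0Pn[y]] := eqVneq (outs centers v) set0.
  by rewrite cards0.
rewrite inE cE => /andP[vy /eqP y2]; suff -> : #|outs centers v| = 2 by [].
rewrite -y2; congr #|pred_of_set _|; apply/setP=> z; rewrite !inE cE.
case: (boolP (e v z)) => //= vz; apply/eqP/eqP => [z2|ez]; last by rewrite /edeg ez.
apply/eqP; apply: contraT => neq; have := edeg_sum vz vy neq.
by rewrite z2 y2.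
Qed.

(** For arcs from [d] to [v] to [u] with [v] odd, the color degrees are 2 at [d] and 1 at [u]. An
    edge between [d] and [u] of the same color would give [u] degree 2; in another color it has
    degree 1 at [d], which is then not its center. *)
Lemma centers_good : good_orientation centers.
Proof.
split; first exact: centers_orientation.
  move=> v /odd_centers[v3 all3]; split=> // u d vu dv.
  have [evu edv] : e v u /\ e d v by move: vu dv => /andP[? _] /andP[? _].
  have evd : e v d by rewrite sym_e.
  have u1 : edeg u v = 1.
    by move: vu; rewrite /centers all3 // evu /= => /eqP.
  have d2 : edeg d v = 2.
    by move: dv; rewrite /centers all3 // andbF orbF => /andP[_ /eqP].
  apply/negP=> /andP[edu]; have neq : col d v != col d u.
    apply/eqP=> ec; have vi : e u v by rewrite sym_e.
    have cvd : col u v = col u d.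
      rewrite (colC u d) -ec (colC d v) (colC u v).
      have : #|[set z | e v z & col v z == col v u]| = #|[set z | e v z]|.
        by rewrite v3 -[RHS](all3 u evu).
      move=> h; have E : [set z | e v z & col v z == col v u] = [set z | e v z].
        by apply/eqP; rewrite eqEcard h leqnn andbT; apply/subsetP=> z; rewrite !inE => /andP[].
      have : d \in [set z | e v z] by rewrite inE.
      by rewrite -E inE => /andP[_ /eqP].
    have : 1 < edeg u v.
      apply/card_gt1P; exists v, d; rewrite !inE vi [e u d]sym_e edu eqxx cvd eqxx.
      by split=> //; apply: contraTneq evd => ->; rewrite irr_e.
    by rewrite u1.
  have := edeg_sum edv edu neq; rewrite d2.
  by case: (edeg d u) => [|[|[|?]]].
move=> v w /odd_centers[_ v3] /odd_centers[_ w3]; apply/negP=> vw.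
by have := edeg_neq vw; rewrite v3 // w3 // sym_e.
Qed.

Lemma four_colorable : exists col : V -> V -> 'I_4, irregular_coloring e col.
Proof.
have [D gD uniq] := merge_odd centers_good.
exact: component_colorable gD uniq.
Qed.

End FromColoring.
End Merge.

(** * Translation to and from colorings of the edge set *)

Section Bridge.
Variable G : sgraph.

Lemma edgeP (E : edge G) : exists p : G * G, adjacent p.1 p.2 /\ val E = [set p.1; p.2].
Proof. by case: E => E /= /imsetP[p]; rewrite inE => pa ->; exists p. Qed.

Lemma color_adjacent_edge k (c : {ffun edge G -> 'I_k}) i x y :
  color_adjacent c i x y -> adjacent x y.
Proof.
move=> h; have xy : x != y by apply: contraTneq h => ->; rewrite color_adjacent_irr.
case/existsP: h => E /andP[/eqP EE _]; have [[a b] /= [ab eab]] := edgeP E.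
have {}EE : [set a; b] = [set x; y] := etrans (esym eab) EE.
have : x \in [set a; b] by rewrite EE !inE eqxx.
have : y \in [set a; b] by rewrite EE !inE eqxx orbT.
rewrite !inE => /orP[] /eqP ey /orP[] /eqP ex; subst x y; rewrite ?eqxx // in xy *.
by rewrite adjacent_sym.
Qed.

Lemma color_adjacent_inj k (c : {ffun edge G -> 'I_k}) i j x y :
  color_adjacent c i x y -> color_adjacent c j x y -> i = j.
Proof.
case/existsP=> E /andP[/eqP e1 /eqP <-] /existsP[E' /andP[/eqP e2 /eqP <-]].
by congr (c _); apply: val_inj; rewrite e1 e2.
Qed.

Lemma adjacent_colored k (c : {ffun edge G -> 'I_k}) x y :
  adjacent x y -> exists i, color_adjacent c i x y.
Proof.
move=> xy; have Ee : [set x; y] \in edges G by apply/imsetP; exists (x, y); rewrite ?inE.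
exists (c (exist _ [set x; y] Ee : edge G)); apply/existsP.
by exists (exist _ [set x; y] Ee : edge G); rewrite !eqxx.
Qed.

(** [None] is the value at nonadjacent pairs; ['I_k] may be empty. *)
Lemma coloring_of_colorable k : locally_irregular_colorable G k ->
  exists col : G -> G -> option 'I_k, irregular_coloring (@adjacent G) col.
Proof.
case/existsP=> c /forallP irr.
pose col x y := [pick i | color_adjacent c i x y].
have colE x y i : adjacent x y && (col x y == Some i) = color_adjacent c i x y.
  apply/andP/idP => [[_]|h].
    by rewrite /col; case: pickP => // j ? /eqP[<-].
  split; first exact: color_adjacent_edge h.
  rewrite /col; case: pickP => [j hj|/(_ i)]; last by rewrite h.
  by rewrite (color_adjacent_inj hj h).
exists col; split=> [x y|x y xy].
  by apply: eq_pick => i; rewrite color_adjacent_sym.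
have [i ci] := adjacent_colored c xy.
have -> : col x y = Some i by apply/eqP; have := colE x y i; rewrite ci => /andP[].
have degE z : cdeg (@adjacent G) col (Some i) z = degree (z : color_subgraph c i).
  by congr #|pred_of_set _|; apply/setP=> w; rewrite !inE colE.
by rewrite !degE; move/forallP/(_ x)/forallP/(_ y)/implyP: (irr i); apply.
Qed.

Lemma colorable_of_coloring k (col : G -> G -> 'I_k.+1) :
  irregular_coloring (@adjacent G) col -> locally_irregular_colorable G k.+1.
Proof.
move=> [colC colP].
(* The ends may be picked in either order, which the symmetry of [col] makes irrelevant; every edge
   has ends, so the default is never reached. *)
pose c : {ffun edge G -> 'I_k.+1} := [ffun E =>
  if [pick p : G * G | adjacent p.1 p.2 && (val E == [set p.1; p.2])] is Some p
  then col p.1 p.2 else ord0].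
have cE i x y : color_adjacent c i x y = adjacent x y && (col x y == i).
  have ccol E : val E = [set x; y] -> adjacent x y -> c E = col x y.
    move=> EE xy; rewrite ffunE; case: pickP => [[a b] /= /andP[ab /eqP Eab]|/(_ (x, y))]; last first.
      by rewrite /= xy EE eqxx.
    have nxy : x != y by apply: contraTneq xy => ->; rewrite adjacent_irr.
    have : x \in [set a; b] by rewrite -Eab EE !inE eqxx.
    have : y \in [set a; b] by rewrite -Eab EE !inE eqxx orbT.
    rewrite !inE => /orP[] /eqP ey /orP[] /eqP ex; subst x y => //; by rewrite eqxx in nxy.
  apply/idP/andP => [h|[xy /eqP ci]].
    have xy := color_adjacent_edge h; split=> //.
    by case/existsP: h => E /andP[/eqP EE]; rewrite (ccol E).
  have [j /existsP[E /andP[EE _]]] := adjacent_colored c xy.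
  by apply/existsP; exists E; rewrite EE (ccol E) ?ci ?eqxx //; apply/eqP.
apply/existsP; exists c; apply/forallP=> i; apply/forallP=> x; apply/forallP=> y.
have degE z : degree (z : color_subgraph c i) = cdeg (@adjacent G) col i z.
  by congr #|pred_of_set _|; apply/setP=> w; rewrite !inE -cE.
apply/implyP; rewrite !degE => h; have := cE i x y; rewrite /= in h; rewrite h.
by move=> /esym/andP[xy /eqP <-]; apply: colP.
Qed.

End Bridge.

Theorem theorem6 (G : sgraph) (dec : decomposable G) (sub : subcubic G) :
  chi_irr dec <= 4.
Proof.
have [k /coloring_of_colorable[col0 col0P]] := dec.
have deg3 x : #|[set y | adjacent (s := G) x y]| <= 3.
  by apply: leq_trans sub; apply: (leq_bigmax (F := @degree G)).
have [col colP] := four_colorable (@adjacent_sym G) (@adjacent_irr G) deg3 col0P.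
rewrite /chi_irr; case: ex_minnP => m _; apply.
exact: colorable_of_coloring colP.
Qed.
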